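(* Let $d\ge 2$ be an integer, let $\nu$ be a probability measure on $(0,+\infty)$, let $R$ be a random variable with distribution $\nu$, and let $s>0$. The following statements are equivalent: (i) for all small enough $\lambda>0$ (that is, there is $\lambda_0>0$ such that for all $\lambda\in(0,\lambda_0)$), $\mathbb{E}(|C|^{s/d})$ is finite; (ii) for all small enough $\lambda>0$, $\mathbb{E}((\#C)^{s/d})$ is finite; (iii) for all small enough $\lambda>0$, $\mathbb{E}(D^s)$ is finite; (iv) $\mathbb{E}(R^{d+s})$ is finite. Moreover, if $\mathbb{E}(R^{d+s})$ is finite, then $\mathbb{E}(|C|^{s/d})$, $\mathbb{E}((\#C)^{s/d})$ and $\mathbb{E}(D^s)$ are finite as soon as $\lambda\in\widehat\Lambda$.
   Context: Boolean model: for $\lambda>0$, let $\xi$ be a Poisson point process on $\mathbb{R}^d\times(0,+\infty)$ with intensity measure $\lambda|\cdot|\otimes\nu$, where $|\cdot|$ is Lebesgue measure on $\mathbb{R}^d$. Set $\Sigma=\bigcup_{(c,r)\in\xi}B(c,r)$, where $B(c,r)$ is the open Euclidean ball with center $c$ and radius $r$. Let $S(r)$ be the Euclidean sphere of radius $r$ centered at the origin. For $A,B\subset\mathbb{R}^d$, $\{A\overset{\Sigma}{\longleftrightarrow}B\}$ is the event that there exists a path in $\Sigma$ from $A$ to $B$. $C$ is the connected component of $\Sigma$ containing the origin ($C=\emptyset$ if $0\notin\Sigma$), $|C|$ is its volume, $D$ is its diameter (equal to $0$ if $C=\emptyset$), and $\#C=\mathrm{card}\{(c,r)\in\xi: c\in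 C\}$. All these depend on $\lambda$. Finally $$\widehat\Lambda=\{\lambda>0:\ \mathbb{P}(S(r)\overset{\Sigma}{\longleftrightarrow}S(2r))\to0\text{ as }r\to\infty\}.$$ *)

(* Defs.v *)
From HB Require Import structures.
From mathcomp Require Import all_boot all_order all_algebra.
From mathcomp Require Import all_classical all_reals all_analysis.
From mathcomp Require Import measurable_realfun.

Set Implicit Arguments.
Unset Strict Implicit.
Unset Printing Implicit Defensive.
Import Order.TTheory GRing.Theory Num.Theory.
Import numFieldNormedType.Exports.

Local Open Scope classical_set_scope.
Local Open Scope ring_scope.

(* Points of R^d are row vectors 'rV[R]_d.  Their library topology comes from
   the sup norm, hence is the usual one; the Euclidean norm is defined below.
   The library has no measurable structure on row vectors: as it does for
   tuples, we take the product sigma-algebra, which is the Borel one. *)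
Definition measure_rV_display : measure_display.
Proof. exact: (measure_tuple_display default_measure_display). Qed.

Section measurable_rV.
Context {R : realType}.
Variable n : nat.

Definition rV_coord (i : 'I_n) (x : 'rV[R]_n) : R := x ord0 i.

Let rV_set0 : g_sigma_preimage rV_coord set0.
Proof. exact: sigma_algebra0. Qed.

Let rV_setC A : g_sigma_preimage rV_coord A ->
  g_sigma_preimage rV_coord (~` A).
Proof. exact: sigma_algebraC. Qed.

Let rV_bigcup (F : (set 'rV[R]_n)^nat) :
  (forall i, g_sigma_preimage rV_coord (F i)) ->
  g_sigma_preimage rV_coord (\bigcup_i (F i)).
Proof. exact: sigma_algebra_bigcup. Qed.

HB.instance Definition _ := @isMeasurable.Build measure_rV_display
  'rV[R]_n (g_sigma_preimage rV_coord) rV_set0 rV_setC rV_bigcup.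

End measurable_rV.

Lemma measurable_rV_coord (R : realType) n (i : 'I_n) :
  measurable_fun [set: 'rV[R]_n] (rV_coord i).
Proof.
move=> _ Y mY; rewrite setTI; apply: sub_sigma_algebra => /=.
rewrite -bigcup_seq/=; exists i => /=; first by rewrite mem_index_enum.
by exists Y => //; rewrite setTI.
Qed.

Lemma measurable_fun_rV d (T : measurableType d) (R : realType) n
    (f : T -> 'rV[R]_n) :
  (forall i, measurable_fun [set: T] (fun t => f t ord0 i)) ->
  measurable_fun [set: T] f.
Proof.
move=> mf _ A mA; rewrite setTI; move: A mA.
suff : g_sigma_preimage (fun i => @rV_coord R n i \o f) `<=` measurable.
  rewrite g_sigma_preimage_comp => H A mA; apply: H.
  by exists A => //; rewrite setTI.
apply: smallest_sub; first exact: sigma_algebra_measurable.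
rewrite -bigcup_seq => A [i _] [B mB <-]; exact: mf.
Qed.

Section lebesgue_rV.
Context {R : realType}.
Local Open Scope ereal_scope.

Definition rV_cons n (p : measurableTypeR R * 'rV[R]_n) : 'rV[R]_n.+1 :=
  row_mx (const_mx p.1 : 'rV[R]_1) p.2.

Lemma measurable_rV_cons n : measurable_fun setT (@rV_cons n).
Proof.
apply: measurable_fun_rV => i.
case: (@split_ordP 1 n i) => j ->.
  rewrite (_ : (fun _ => _) = fst); first exact: measurable_fst.
  by apply/funext => t; rewrite /rV_cons (@row_mxEl _ _ 1) mxE.
rewrite (_ : (fun _ => _) = rV_coord j \o snd).
  exact: measurableT_comp (measurable_rV_coord j) measurable_snd.
by apply/funext => t; rewrite /rV_cons (@row_mxEr _ _ 1).
Qed.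

Section lebesgue_rVS.
Variables (n : nat) (m : {measure set 'rV[R]_n -> \bar R}).

Definition lebesgue_rVS : set 'rV[R]_n.+1 -> \bar R :=
  pushforward (@lebesgue_measure R \x^ m) (@rV_cons n).

Let lebesgue_rVS0 : lebesgue_rVS set0 = 0.
Proof. by rewrite /lebesgue_rVS /pushforward preimage_set0 measure0. Qed.

Let lebesgue_rVS_ge0 A : 0 <= lebesgue_rVS A.
Proof. exact: (measure_ge0 (lebesgue_measure \x^ m)). Qed.

Let lebesgue_rVS_sigma_additive : semi_sigma_additive lebesgue_rVS.
Proof.
move=> F mF tF mUF; rewrite /lebesgue_rVS /pushforward preimage_bigcup.
apply: measure_semi_sigma_additive.
- by move=> k; rewrite -[X in measurable X]setTI; exact: measurable_rV_cons.
- apply/trivIsetP => /= i j _ _ ij; rewrite -preimage_setI.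
  by move/trivIsetP : tF => /(_ _ _ _ _ ij) ->//; rewrite preimage_set0.
- by rewrite -preimage_bigcup -[X in measurable X]setTI;
    exact: measurable_rV_cons.
Qed.

HB.instance Definition _ := isMeasure.Build _ _ _ lebesgue_rVS
  lebesgue_rVS0 lebesgue_rVS_ge0 lebesgue_rVS_sigma_additive.

End lebesgue_rVS.

(* Lebesgue measure on R^n: image of |.| (x) |.|_n under R x R^n = R^n.+1. *)
Fixpoint lebesgue_rV n : {measure set 'rV[R]_n -> \bar R} :=
  if n is n'.+1 then lebesgue_rVS (lebesgue_rV n') else dirac (0%R : 'rV[R]_0).

End lebesgue_rV.

Definition enorm (R : realType) n (x : 'rV[R]_n) : R :=
  Num.sqrt (\sum_(i < n) x ord0 i ^+ 2).

Definition eball (R : realType) n (c : 'rV[R]_n) (r : R) : set 'rV[R]_n :=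
  [set x | enorm (x - c) < r].

Definition esphere (R : realType) n (r : R) : set 'rV[R]_n :=
  [set x | enorm x = r].

(* Euclidean diameter; adjoining 0 only matters for the empty set. *)
Definition ediam (R : realType) n (A : set 'rV[R]_n) : \bar R :=
  ereal_sup (0%E |` [set (enorm (x - y))%:E | x in A & y in A]).

Definition path_between (R : realType) n (S A B : set 'rV[R]_n) : Prop :=
  exists f : R -> 'rV[R]_n, [/\ {within `[0, 1], continuous f},
    forall t, t \in `[0, 1] -> S (f t), A (f 0) & B (f 1)].

Section poisson_point_process.
Context {R : realType} (n : nat) {dO : measure_display}
  {Omega : measurableType dO} (P : probability Omega R).

Definition mutually_independent k (X : 'I_k -> Omega -> \bar R) : Prop :=
  forall B : 'I_k -> set (\bar R), (forall i, measurable (B i)) ->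
    P (\bigcap_i (X i @^-1` B i)) = (\prod_(i < k) P (X i @^-1` B i))%E.

Variable xi : Omega -> set ('rV[R]_n * R).

Definition npoints (A : set ('rV[R]_n * R)) (w : Omega) : \bar R :=
  counting (xi w `&` A).

(* A point process on R^n x ]0, +oo[ is a random locally finite set of points;
   no multiplicities are needed for the (atomless) intensities used below.
   In poisson_prob, the second argument is unused, and a zero mean gives the
   Dirac mass at 0. *)
Record poisson_point_process (mu : set ('rV[R]_n * R) -> \bar R) : Prop := {
  ppp_pos : forall w p, xi w p -> 0 < p.2 ;
  ppp_locally_finite : forall w (K : set ('rV[R]_n * R)), compact K ->
    K `<=` [set p | 0 < p.2] -> finite_set (xi w `&` K) ;
  ppp_measurable : forall A, measurable A ->
    measurable_fun [set: Omega] (npoints A) ;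
  ppp_poisson : forall A, measurable A -> (mu A < +oo)%E -> forall k : nat,
    P [set w | npoints A w = k%:R%:E] = poisson_prob (fine (mu A)) 0%N [set k] ;
  ppp_infinite : forall A, measurable A -> mu A = +oo%E ->
    P [set w | npoints A w = +oo%E] = 1%E ;
  ppp_independent : forall k (A : 'I_k -> set ('rV[R]_n * R)),
    (forall i, measurable (A i)) -> trivIset setT A ->
    mutually_independent (fun i => npoints (A i)) }.

End poisson_point_process.

Section boolean_model.
Context {R : realType} (d : nat).

Definition boolean_intensity (nu : probability R R) (lambda : R) :
    set ('rV[R]_d * R) -> \bar R :=
  fun A => (lambda%:E * (lebesgue_rV d \x nu) A)%E.

Variable xi : set ('rV[R]_d * R).

Definition boolean_set : set 'rV[R]_d :=
  \bigcup_(p in xi) eball p.1 p.2.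

(* Empty when 0 is not in boolean_set, by definition of connected_component. *)
Definition origin_cluster : set 'rV[R]_d :=
  connected_component boolean_set 0.

Definition cluster_volume : \bar R := lebesgue_rV d origin_cluster.

Definition cluster_card : \bar R :=
  counting (xi `&` [set p | origin_cluster p.1]).

Definition cluster_diam : \bar R := ediam origin_cluster.

End boolean_model.

(* xi lambda is the process of parameter lambda, which may live on its own
   probability space. *)
Definition Lambda_hat (R : realType) d (dO : R -> measure_display)
    (Omega : forall lambda, measurableType (dO lambda))
    (P : forall lambda, probability (Omega lambda) R)
    (xi : forall lambda, Omega lambda -> set ('rV[R]_d * R)) : set R :=
  [set lambda | 0 < lambda /\
    P lambda [set w | path_between (boolean_set (xi lambda w))
                        (@esphere R d r) (@esphere R d (2 * r))]
      @[r --> +oo] --> 0%E].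

(* Main.v *)
(* The radius condition is equivalent to the finiteness of the series
   sum_k b^k T^(kd) nu[T^k, T^(k+1)[, where b = T^s and T is a fixed scale ratio.

   If the series is finite, let p_j be the probability that a chain of balls with
   centers near the origin joins the box of radius T^j to the complement of a
   larger box of comparable radius.  When no ball of radius at least T^j is
   centered near the larger box, such a crossing at scale T^(j+1) contains two
   crossings at scale T^j around points so far apart that they are independent;
   hence p_(j+1) <= C p_j^2 + delta_j, where delta_j bounds the probability of
   big balls and sum_j b^j delta_j is finite.  As soon as p_j is eventually small,
   which holds for lambda in Lambda_hat and also for all small lambda, this forces
   sum_j b^j p_j to be finite.  Off an event of probability at most p_j + delta_j
   the cluster is contained in a box of radius comparable to T^j; for the number
   of points one also excludes a Poisson deviation.

   Conversely, with probability 1 - exp(- c T^(kd) nu[T^k, T^(k+1)[) some ball of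
   radius at least T^k covers a box of radius comparable to T^k around the origin,
   which bounds the diameter and the volume from below; the number of points in
   that box is controlled by the independent points of radius less than T^k. *)

Require Import Defs.
From mathcomp Require Import all_boot all_order all_algebra.
From mathcomp Require Import all_classical all_reals all_analysis.
From mathcomp Require Import measurable_realfun ring lra.
Set Implicit Arguments.
Unset Strict Implicit.
Unset Printing Implicit Defensive.
Import Order.TTheory GRing.Theory Num.Theory.
Import numFieldNormedType.Exports.
Local Open Scope classical_set_scope.
Local Open Scope ring_scope.

(** * Euclidean norm, boxes and chains of balls *)

(** The process only comes with laws and independence of counts in finitely many disjoint sets,
    whereas crossings, clusters and paths depend on the whole configuration. Openness bridges the
    gap: a finite chain of overlapping open balls survives small changes of centers and radii, so it
    can be read off a fine enough grid. The probabilistic estimates are therefore stated for chains,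
    and paths and clusters are translated into chains.

    Boxes of the sup norm serve as scales because their measure is explicit. With
    [out_ratio = 2 * n], a crossing from [inner a] to [outer a] joins the Euclidean spheres of radii
    [n * a] and [2 * n * a], which is the event in [Lambda_hat]. With [ctr_ratio = out_ratio + 2],
    the window contains the center of every ball of radius at most [2 * a] that meets the box of
    radius [out_ratio * a]. Finally [scale = 2 * ctr_ratio + 4] keeps the two windows of the
    recursion apart. *)

Section euclid.
Context {R : realType} (n : nat).
Implicit Types (x y z c : 'rV[R]_n).

Lemma norm_coord_le x i : `|x ord0 i| <= `|x|.
Proof.
rewrite [leRHS]/Num.Def.normr/= mx_normrE.
exact: (le_bigmax _ (fun ij : 'I_1 * 'I_n => `|x ij.1 ij.2|) (ord0, i)).
Qed.

Lemma norm_rV_le x e : 0 <= e -> (forall i, `|x ord0 i| <= e) -> `|x| <= e.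
Proof.
move=> e0 xe; rewrite [leLHS]/Num.Def.normr/= mx_normrE.
by apply/bigmax_leP; split=> // -[i j] _ /=; rewrite ord1.
Qed.

Lemma norm_rV_lt x e : 0 < e -> (forall i, `|x ord0 i| < e) -> `|x| < e.
Proof.
move=> e0 xe; rewrite [ltLHS]/Num.Def.normr/= mx_normrE.
by apply/bigmax_ltP; split=> // -[i j] _ /=; rewrite ord1.
Qed.

Lemma enorm_ge0 x : 0 <= enorm x.
Proof. exact: sqrtr_ge0. Qed.

Lemma norm_le_enorm x : `|x| <= enorm x.
Proof.
apply: norm_rV_le (enorm_ge0 x) _ => i.
rewrite -sqrtr_sqr ler_sqrt ?sumr_ge0//; last by move=> j _; exact: sqr_ge0.
rewrite (bigD1 i)//= lerDl sumr_ge0// => j _; exact: sqr_ge0.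
Qed.

Lemma enorm_le_norm x : enorm x <= n%:R * `|x|.
Proof.
rewrite -[leRHS]ger0_norm ?mulr_ge0// -sqrtr_sqr ler_wsqrtr// exprMn.
apply: (@le_trans _ _ (\sum_(i < n) `|x| ^+ 2)).
  apply: ler_sum => i _; rewrite -real_normK ?num_real// lerXn2r ?nnegrE//.
  exact: norm_coord_le.
rewrite sumr_const card_ord -[leLHS]mulr_natl ler_wpM2r ?sqr_ge0//.
by rewrite -natrX ler_nat; case: n => // k; rewrite expnS leq_pmulr.
Qed.

Lemma enorm0 : enorm (0 : 'rV[R]_n) = 0.
Proof.
by rewrite /enorm big1 ?sqrtr0// => i _; rewrite mxE expr0n.
Qed.

Lemma enormZ a x : enorm (a *: x) = `|a| * enorm x.
Proof.
rewrite /enorm -sqrtr_sqr -sqrtrM ?sqr_ge0// mulr_sumr.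
by congr Num.sqrt; apply: eq_bigr => i _; rewrite mxE exprMn.
Qed.

Lemma continuous_enorm : continuous (@enorm R n).
Proof.
move=> x; apply: (@continuous_comp _ _ _
  (fun x : 'rV[R]_n => \sum_(i < n) x ord0 i ^+ 2)
  (@Num.sqrt R)); last exact: sqrt_continuous.
apply: (@cvg_big R 'I_n +%R 0 xpredT add_continuous _ (nbhs x)) => i _.
apply: (@continuous_comp _ _ _ (fun x : 'rV[R]_n => x ord0 i)
  (fun y : R => y ^+ 2)); first exact: coord_continuous.
exact: exprn_continuous.
Qed.

Lemma open_eball_param z : open [set p : 'rV[R]_n * R | eball p.1 p.2 z].
Proof.
have -> : [set p : 'rV[R]_n * R | eball p.1 p.2 z] =
    (fun p => p.2 - enorm (z - p.1)) @^-1` [set y | 0 < y].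
  by apply/seteqP; split=> p /=; rewrite /eball/= subr_gt0.
apply: open_comp; last exact: open_gt.
move=> p _; apply: cvgB; first exact: cvg_snd.
apply: (@continuous_comp _ _ _ (fun p : 'rV[R]_n * R => z - p.1) (@enorm R n)).
  by apply: cvgB; [exact: cvg_cst|exact: cvg_fst].
exact: continuous_enorm.
Qed.

Lemma open_eball c r : open (eball c r).
Proof.
have -> : eball c r = (fun z => enorm (z - c)) @^-1` [set y | y < r].
  by [].
apply: open_comp; last exact: open_lt.
have cB : continuous (fun z : 'rV[R]_n => z - c).
  by move=> z; apply: (@continuousB _ _ _ id (cst c)); [move=> ?; exact|exact: cst_continuous].
by move=> z _; exact: continuous_comp (cB z) (@continuous_enorm _).
Qed.

Lemma eball_center c r : 0 < r -> eball c r c.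
Proof. by rewrite /eball/= subrr enorm0. Qed.

Lemma eball_radius_gt0 c r z : eball c r z -> 0 < r.
Proof. exact: le_lt_trans (enorm_ge0 _). Qed.

Lemma eball_norm c r z : eball c r z -> `|z - c| < r.
Proof. exact: le_lt_trans (norm_le_enorm _). Qed.

Definition star_shaped (x : 'rV[R]_n) (A : set 'rV[R]_n) :=
  forall y (t : R), A y -> 0 <= t <= 1 -> A (x + t *: (y - x)).

Lemma star_eball c r : star_shaped c (eball c r).
Proof.
move=> y t; rewrite /eball/= addrAC subrr add0r enormZ => yr /andP[t0 t1].
rewrite ger0_norm//; apply: le_lt_trans yr.
by rewrite -[leRHS]mul1r ler_wpM2r// enorm_ge0.
Qed.

Lemma continuous_line x y : continuous (fun t : R => x + t *: (y - x)).
Proof.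
move=> t; apply: cvgD; first exact: cvg_cst.
exact: cvgZr_tmp.
Qed.

Lemma connected_star x A : star_shaped x A -> connected A.
Proof.
move=> sA; have [[a Aa]|A0] := pselect (A !=set0); last first.
  have -> : A = set0 by apply/seteqP; split=> // z Az; apply: A0; exists z.
  exact: connected0.
pose seg y := (fun t : R => x + t *: (y - x)) @` `[0, 1]%classic.
have Ax : A x.
  by have := sA a 0 Aa; rewrite scale0r addr0; apply; rewrite lexx ler01.
have -> : A = \bigcup_(y in A) seg y.
  apply/seteqP; split=> [y Ay|y [z Az] [t]].
    exists y => //; exists 1; first by rewrite /= in_itv/= ler01 lexx.
    by rewrite scale1r addrC subrK.
  by rewrite /= in_itv/= => t01 <-; exact: sA.
apply: bigcup_connected.
  exists x => y Ay; exists 0; last by rewrite scale0r addr0.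
  by rewrite /= in_itv/= ler01 lexx.
move=> y Ay; apply: connected_continuous_connected.
  exact: segment_connected.
exact/continuous_subspaceT/continuous_line.
Qed.

End euclid.

Section chains.
Context {R : realType} (n : nat).
Local Notation pt := ('rV[R]_n * R)%type.
Implicit Types (S : set pt) (A B : set 'rV[R]_n) (p q : pt).

Definition hits A p := eball p.1 p.2 `&` A !=set0.

Definition touches p q := hits (eball p.1 p.2) q.

(** Chains replace paths as the basic object: a link is witnessed by one point common to two open
    balls, so a finite chain is stable under perturbation of its balls, and induction peels off the
    last ball. *)
Inductive chained S A : pt -> Prop :=
| chained_first p : S p -> hits A p -> chained S A p
| chained_next p q : chained S A p -> S q -> touches p q -> chained S A q.

Definition crosses S A B := exists2 p, chained S A p & hits B p.

Lemma chained_in S A p : chained S A p -> S p.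
Proof. by case. Qed.

Lemma chained_sub S S' A A' : S `<=` S' -> A `<=` A' ->
  chained S A `<=` chained S' A'.
Proof.
move=> SS AA p; elim=> [{}p Sp [z [pz Az]]|{}p q _ IH Sq pq].
  by apply: chained_first; [exact: SS|exists z; split=> //; exact: AA].
by apply: chained_next IH _ pq; exact: SS.
Qed.

Lemma crosses_sub S S' A A' B B' : S `<=` S' -> A `<=` A' -> B `<=` B' ->
  crosses S A B -> crosses S' A' B'.
Proof.
move=> SS AA BB [p pA [z [pz Bz]]]; exists p; first exact: chained_sub pA.
by exists z; split=> //; exact: BB.
Qed.

(** Cutting tool: it trims a chain at its first exit from [V], so that everything before the exit
    can be localized. *)
Lemma chained_exit S A (V : set pt) p : chained S A p ->
  chained (S `&` V) A p \/
  exists q, [/\ S q, ~ V q &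
    hits A q \/ exists2 q', chained (S `&` V) A q' & touches q' q].
Proof.
elim=> [{}p Sp pA|{}p q pS IH Sq pq].
  have [Vp|nVp] := pselect (V p); first by left; exact: chained_first.
  by right; exists p; split=> //; left.
case: IH => [pV|]; last by right.
have [Vq|nVq] := pselect (V q); first by left; apply: chained_next pV _ pq.
by right; exists q; split=> //; right; exists p.
Qed.

Lemma open_hits A : open (hits A).
Proof.
have -> : hits A = \bigcup_(z in A) [set p | eball p.1 p.2 z].
  apply/seteqP; split=> [p [z [pz Az]]|p [z Az pz]]; first by exists z.
  by exists z.
by apply: bigcup_open => z _; exact: open_eball_param.
Qed.

Lemma touches_common p q z : eball p.1 p.2 z -> eball q.1 q.2 z -> touches p q.
Proof. by move=> pz qz; exists z. Qed.

(* The points reachable from [a] are relatively clopen in the covered set, and a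
   connected set cannot be split by a clopen one. *)
Lemma connected_chained S (D : set 'rV[R]_n) a y :
  connected D -> D `<=` boolean_set S -> D a -> D y ->
  exists2 p, chained S [set a] p & eball p.1 p.2 y.
Proof.
move=> cD DS Da Dy.
pose Z := \bigcup_(p in chained S [set a]) eball p.1 p.2.
pose W := \bigcup_(p in S `\` chained S [set a]) eball p.1 p.2.
have oZ : open Z by apply: bigcup_open => p _; exact: open_eball.
have oW : open W by apply: bigcup_open => p _; exact: open_eball.
have ZW z : Z z -> W z -> False.
  move=> [p pa pz] [q [Sq nq] qz]; apply: nq.
  by apply: chained_next pa Sq _; exact: touches_common qz.
have DZ : D `&` Z = D.
  apply: cD.
  - exists a; split=> //; have [p Sp pa] := DS a Da.
    by exists p => //; apply: chained_first => //; exists a.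
  - by exists Z.
  - exists (~` W); first exact: open_closedC.
    apply/seteqP; split=> z [Dz Zz]; split=> //.
      by move=> Wz; exact: (ZW z).
    have [p Sp pz] := DS z Dz.
    have [pa|npa] := pselect (chained S [set a] p); first by exists p.
    by exfalso; apply: Zz; exists p.
have [_ [p pa py]] : (D `&` Z) y by rewrite DZ.
by exists p.
Qed.

Lemma origin_cluster_chained S y : origin_cluster S y ->
  exists2 p, chained S [set 0] p & eball p.1 p.2 y.
Proof.
move=> Cy; apply: (@connected_chained S (origin_cluster S)) => //.
- exact: component_connected.
- exact: connected_component_sub.
- apply: connected_component_refl.
  apply: contrapT => n0; move: Cy.
  by rewrite /origin_cluster connected_component_out.
Qed.

Lemma subset_origin_cluster S (D : set 'rV[R]_n) y :
  connected D -> D `<=` boolean_set S -> origin_cluster S y -> D y ->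
  D `<=` origin_cluster S.
Proof.
move=> cD DS Cy Dy z Dz.
apply: connected_component_trans Cy _.
by exists D.
Qed.

Lemma eball_sub_boolean_set S p : S p -> eball p.1 p.2 `<=` boolean_set S.
Proof. by move=> Sp z pz; exists p. Qed.

(** A ball that meets the cluster is connected, hence lies in it; so the cluster is a union of open
    balls. This is what makes its volume comparable with that of boxes. *)
Lemma open_origin_cluster S : open (origin_cluster S).
Proof.
have -> : origin_cluster S =
    \bigcup_(p in [set p | S p /\ hits (origin_cluster S) p]) eball p.1 p.2.
  apply/seteqP; split=> [z Cz|z [p [Sp [y [py Cy]]]]].
    have [p Sp pz] := connected_component_sub Cz.
    by exists p => //; split=> //; exists z.
  apply: (subset_origin_cluster _ _ Cy) => //; last exact: eball_sub_boolean_set.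
  exact: connected_star (@star_eball _ _ _ _).
by apply: bigcup_open => p _; exact: open_eball.
Qed.

End chains.

(** * Discretization of chains *)

Section slots.
Context {R : realType}.
Implicit Types (m k : nat) (y : R).

(* The grid of mesh [1 / m.+1] on [[-m.+1, m.+1[]. *)
Definition slot_count m := (2 * m.+1 ^ 2)%N.

Definition corner m k : R := (k%:R - (m.+1 ^ 2)%:R) / m.+1%:R.

Definition slot m k : set R := `[corner m k, corner m k.+1[%classic.

Lemma slotP m k y : slot m k y <->
  k%:R <= y * m.+1%:R + (m.+1 ^ 2)%:R < k.+1%:R.
Proof.
rewrite /slot /corner /= in_itv/= ler_pdivrMr ?ltr0n// ltr_pdivlMr ?ltr0n//.
by rewrite lerBlDr ltrBrDr.
Qed.

Lemma slot_inj m k k' y : slot m k y -> slot m k' y -> k = k'.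
Proof.
by move=> /slotP /truncn_def <- /slotP /truncn_def <-.
Qed.

Lemma slot_ex m y : `|y| < m.+1%:R ->
  exists k : 'I_(slot_count m), slot m k y.
Proof.
rewrite ltr_norml => /andP[y1 y2].
have N0 : 0 < m.+1%:R :> R by rewrite ltr0n.
set t := y * m.+1%:R + (m.+1 ^ 2)%:R.
have t0 : 0 <= t by rewrite /t natrX; nra.
have tN : (Num.trunc t < slot_count m)%N.
  rewrite -(ltr_nat R); apply: le_lt_trans (proj1 (andP (truncn_itv t0))) _.
  by rewrite /slot_count /t natrM natrX; nra.
by exists (Ordinal tN); apply/slotP/truncn_itv.
Qed.

Lemma slot_diam m k y y' : slot m k y -> slot m k y' -> `|y - y'| < m.+1%:R^-1.
Proof.
move=> /slotP/andP[a b] /slotP/andP[a' b'].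
have N0 : 0 < m.+1%:R :> R by rewrite ltr0n.
move: a b a' b'; rewrite -[k.+1]addn1 natrD => a b a' b'.
rewrite -(@ltr_pM2r _ m.+1%:R)// mulVf ?gt_eqF//.
rewrite -[X in _ * X](ger0_norm (ltW N0)) -normrM mulrBl ltr_norml.
by apply/andP; split; lra.
Qed.

Lemma measurable_slot m k : measurable (slot m k).
Proof. exact: measurable_itv. Qed.

Lemma lebesgue_slot m k : lebesgue_measure (slot m k) = (m.+1%:R^-1)%:E.
Proof.
have cc : corner m k.+1 - corner m k = m.+1%:R^-1.
  by rewrite /corner -mulrBl -[k.+1]addn1 natrD -[RHS]mul1r; congr (_ * _); ring.
rewrite lebesgue_measure_itv/= lte_fin -subr_gt0 cc invr_gt0 ltr0n.
by rewrite -EFinB cc.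
Qed.

End slots.

Section cells.
Context {R : realType} (n : nat).
Local Notation pt := ('rV[R]_n * R)%type.
Implicit Types (S O : set pt) (A B : set 'rV[R]_n) (p q : pt).

Definition cell_index (m : nat) : finType :=
  ({ffun 'I_n -> 'I_(slot_count m)} * 'I_(slot_count m))%type.

Definition box_cell m (g : 'I_n -> 'I_(slot_count m)) : set 'rV[R]_n :=
  [set x | forall l, slot m (g l) (x ord0 l)].

Definition cell m (i : cell_index m) : set pt := box_cell i.1 `*` slot m i.2.

Lemma cell_inj m (i j : cell_index m) p : cell i p -> cell j p -> i = j.
Proof.
case: i j => [g k] [h l] [/= pg pk] [/= ph pl]; congr (_, _).
  by apply/ffunP => a; apply/val_inj/(slot_inj (pg a) (ph a)).
exact/val_inj/(slot_inj pk pl).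
Qed.

Lemma cell_near p O : open O -> O p -> exists m0, forall m, (m0 <= m)%N ->
  exists2 i : cell_index m, cell i p & cell i `<=` O.
Proof.
move=> oO Op; have /nbhs_ballP[e /= e0 peO] : nbhs p O by exact: open_nbhs_nbhs.
(* Once [m.+1] exceeds both norms the grid reaches [p]; once it exceeds [e^-1] the cells are
   narrower than [e]. *)
pose M := Num.max (Num.max `|p.1| `|p.2|) e^-1.
exists (Num.trunc M) => m mM.
have Mm : M < m.+1%:R.
  by apply: lt_le_trans (truncnS_gt M) _; rewrite ler_nat ltnS.
move: Mm; rewrite /M !gt_max -andbA => /and3P[p1 p2 em].
have {}em : m.+1%:R^-1 < e by rewrite invf_plt ?posrE.
have [k pk] := slot_ex p2.
have pg l : exists g : 'I_(slot_count m), slot m g (p.1 ord0 l).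
  by apply: slot_ex; apply: le_lt_trans p1; exact: norm_coord_le.
pose g := [ffun l => projT1 (cid (pg l))].
have pg' l : slot m (g l) (p.1 ord0 l) by rewrite ffunE; case: cid.
exists (g, k) => // q [qg qk]; apply: peO; split=> /=.
  rewrite -ball_normE/=; apply: norm_rV_lt => // l.
  by rewrite !mxE; apply: lt_trans em; apply: slot_diam (pg' l) (qg l).
rewrite -ball_normE/=; apply: lt_trans em; exact: slot_diam pk qk.
Qed.

Section cell_chain.
Variables (U : set pt) (A B : set 'rV[R]_n) (m : nat).
Variable occ : cell_index m -> Prop.

(** Links are required for all pairs of points of the two cells, so that occupancy alone forces a
    genuine chain, wherever the points sit in their cells. *)
Inductive cell_chained : cell_index m -> Prop :=
| cell_chained_first i : occ i -> cell i `<=` U `&` hits A -> cell_chained i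
| cell_chained_next i j : cell_chained i -> occ j -> cell j `<=` U ->
    (forall p q, cell i p -> cell j q -> touches p q) -> cell_chained j.

Definition cell_crosses := exists2 i, cell_chained i & cell i `<=` hits B.

End cell_chain.

Definition occupied S m (i : cell_index m) := S `&` cell i !=set0.

Lemma cell_chained_chained S U A m (i : cell_index m) :
  cell_chained U A (@occupied S m) i ->
  [/\ occupied S i, cell i `<=` U &
    forall p, cell i p -> S p -> chained (S `&` U) A p].
Proof.
elim=> [{}i Si iUA|{}i j _ [[p [Sp ip]] iU IH] Sj jU ij].
  split=> // [q /iUA[]//|q iq Sq]; have [Uq qA] := iUA q iq.
  exact: chained_first.
split=> // q jq Sq; apply: (chained_next (IH p ip Sp)); last exact: ij.
by split=> //; exact: jU.
Qed.

Lemma cell_crosses_crosses S U A B m :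
  cell_crosses U A B (@occupied S m) -> crosses (S `&` U) A B.
Proof.
move=> [i /cell_chained_chained[[p [Sp ip]] _ ic] iB].
by exists p; [exact: ic|exact: iB].
Qed.

(** A point [z] common to two balls stays in both when centers and radii move slightly, so each link
    is seen by every fine enough grid; a chain has finitely many links, whence one threshold
    [m0]. *)
Lemma chained_cell_chained S U A p : open U -> chained (S `&` U) A p ->
  exists m0, forall m, (m0 <= m)%N -> forall i : cell_index m, cell i p ->
    cell_chained U A (@occupied S m) i.
Proof.
move=> oU; elim=> [{}p [Sp Up] pA|{}p q _ [m1 IH] [Sq Uq] pq].
  have [m0 m0P] := @cell_near p (U `&` hits A) (openI oU (@open_hits _ _ A))
    (conj Up pA).
  exists m0 => m /m0P[j jp jU] i ip; rewrite (cell_inj ip jp).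
  by apply: cell_chained_first => //; exists p.
have [z [qz pz]] := pq.
have [m2 m2P] := @cell_near p [set p | eball p.1 p.2 z] (@open_eball_param _ _ z) pz.
have [m3 m3P] := @cell_near q ([set p | eball p.1 p.2 z] `&` U)
  (openI (@open_eball_param _ _ z) oU) (conj qz Uq).
exists (maxn m1 (maxn m2 m3)) => m.
rewrite !geq_max => /and3P[le1 /m2P[i ip iz] /m3P[j jq jz]] j' jq'.
rewrite (cell_inj jq' jq).
apply: (cell_chained_next (IH m le1 i ip)).
- by exists q.
- by move=> x /jz[].
- by move=> p' q' /iz p'z /jz[q'z _]; exact: (@touches_common _ _ p' q' z).
Qed.

Lemma crosses_cell_crosses S U A B : open U -> crosses (S `&` U) A B ->
  exists m0, forall m, (m0 <= m)%N -> cell_crosses U A B (@occupied S m).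
Proof.
move=> oU [p pA pB]; have [m1 m1P] := chained_cell_chained oU pA.
have [m2 m2P] := @cell_near p (hits B) (@open_hits _ _ B) pB.
exists (maxn m1 m2) => m; rewrite geq_max => /andP[le1 /m2P[i ip iB]].
by exists i => //; exact: m1P.
Qed.

End cells.

(** * Measure of boxes *)

Section boxes.
Context {R : realType}.

Definition box n (I : 'I_n -> set R) : set 'rV[R]_n :=
  [set x | forall i, I i (x ord0 i)].

Lemma measurable_box n (I : 'I_n -> set R) :
  (forall i, measurable (I i)) -> measurable (box I).
Proof.
move=> mI; have -> : box I = \bigcap_(i in [set: 'I_n]) (rV_coord i @^-1` I i).
  by apply/seteqP; split=> [x xI i _|x xI i]; exact: xI.
apply: fin_bigcap_measurable => // i _.
by rewrite -[X in measurable X]setTI; exact: measurable_rV_coord.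
Qed.

Lemma lebesgue_box n (I : 'I_n -> set R) : (forall i, measurable (I i)) ->
  lebesgue_rV n (box I) = (\prod_(i < n) lebesgue_measure (I i))%E.
Proof.
elim: n I => [|n IH] I mI.
  rewrite big_ord0 /= diracE mem_set//; by case.
rewrite big_ord_recl -IH; last by move=> i; exact: mI.
rewrite /= /lebesgue_rVS /pushforward.
rewrite (_ : _ @^-1` _ = I ord0 `*` box (fun i => I (lift ord0 i))).
  rewrite product_measure2E//; [exact: mI|by apply: measurable_box => i; exact: mI].
apply/seteqP; split=> [[y x] xI|[y x] [/= yI xI] i].
  split=> [|i]; [have := xI ord0|have := xI (lift ord0 i)].
    rewrite /= /rV_cons -[ord0](lshift0 n (ord0 : 'I_1)).
    by rewrite (@row_mxEl _ 1 1 n) mxE /= (lshift0 n).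
  rewrite /= /rV_cons -[lift _ _]rshift1.
  by rewrite (@row_mxEr _ 1 1 n).
case: (@split_ordP 1 n i) => j ->.
  by rewrite (@row_mxEl _ 1 1 n) mxE /= (ord1 j) (lshift0 n).
by rewrite (@row_mxEr _ 1 1 n) rshift1; exact: xI.
Qed.

Lemma open_boxE n (a : R) : 0 < a ->
  [set z : 'rV[R]_n | `|z| < a] = box (fun=> `]-a, a[%classic).
Proof.
move=> a0; apply/seteqP; split=> [z za i|z za] /=.
  by rewrite in_itv/= -ltr_norml; apply: le_lt_trans za; exact: norm_coord_le.
by apply: norm_rV_lt => // i; have := za i; rewrite /= in_itv/= -ltr_norml.
Qed.

Lemma measurable_open_box n (a : R) : measurable [set z : 'rV[R]_n | `|z| < a].
Proof.
have [a0|a0] := ltP 0 a.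
  by rewrite open_boxE//; apply: measurable_box => i; exact: measurable_itv.
rewrite (_ : mkset _ = set0)//; apply/seteqP; split=> // z /=.
by move=> /(le_lt_trans (normr_ge0 _)) /(le_lt_trans a0); rewrite ltxx.
Qed.

Lemma lebesgue_open_box n (a : R) : 0 < a ->
  lebesgue_rV n [set z | `|z| < a] = ((2 * a) ^+ n)%:E.
Proof.
move=> a0; rewrite open_boxE// lebesgue_box; last first.
  by move=> i; exact: measurable_itv.
rewrite (eq_bigr (fun=> (2 * a)%:E)).
  by rewrite prodEFin prodr_const card_ord.
move=> i _; rewrite lebesgue_measure_itv/= lte_fin gt0_cp// -EFinB.
by congr EFin; ring.
Qed.

Lemma boolean_intensity_rect n (nu : probability R R) (lambda : R)
    (B : set 'rV[R]_n) (I : set R) : measurable B -> measurable I ->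
  boolean_intensity nu lambda (B `*` I) =
  (lambda%:E * (lebesgue_rV n B * nu I))%E.
Proof. by move=> mB mI; rewrite /boolean_intensity product_measure1E. Qed.

Definition shifted_cell n (x : 'rV[R]_n) m (i : cell_index n m) :
    set ('rV[R]_n * R) := [set p | cell i (p.1 - x, p.2)].

Lemma shifted_cellE n (x : 'rV[R]_n) m (i : cell_index n m) :
  shifted_cell x i =
  box (fun l => `[corner m (i.1 l) + x ord0 l,
                  corner m (i.1 l).+1 + x ord0 l[%classic) `*` slot m i.2.
Proof.
apply/seteqP; split=> [p [/= pi pj]|p [/= pi pj]]; split=> // l.
  by have := pi l; rewrite /slot /= !in_itv/= !mxE lerBrDr ltrBlDr.
by have := pi l; rewrite /slot /= !in_itv/= !mxE lerBrDr ltrBlDr.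
Qed.

Lemma measurable_shifted_cell n (x : 'rV[R]_n) m (i : cell_index n m) :
  measurable (shifted_cell x i).
Proof.
rewrite shifted_cellE; apply: measurableX; last exact: measurable_slot.
by apply: measurable_box => l; exact: measurable_itv.
Qed.

(** The right-hand side is free of [x]: this is the form of translation invariance from which the
    stationarity of crossings is deduced. *)
Lemma boolean_intensity_shifted_cell n (nu : probability R R) (lambda : R)
    (x : 'rV[R]_n) m (i : cell_index n m) :
  boolean_intensity nu lambda (shifted_cell x i) =
  (lambda%:E * ((m.+1%:R^-1 ^+ n)%:E * nu (slot m i.2)))%E.
Proof.
rewrite shifted_cellE boolean_intensity_rect//; last exact: measurable_slot.
  rewrite lebesgue_box => [|l]; last exact: measurable_itv.
  rewrite (eq_bigr (fun=> (m.+1%:R^-1)%:E)) ?prodEFin ?prodr_const ?card_ord//.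
  move=> l _; rewrite -(@lebesgue_slot R m (i.1 l)).
  rewrite /slot !lebesgue_measure_itv/= !lte_fin ltrD2r.
  by case: ifP => // _; rewrite -!EFinB; congr EFin; ring.
by apply: measurable_box => l; exact: measurable_itv.
Qed.

Lemma boolean_intensity_ge0 n (nu : probability R R) (lambda : R)
  (A : set ('rV[R]_n * R)) : 0 <= lambda ->
  (0 <= boolean_intensity nu lambda A)%E.
Proof. by move=> l0; rewrite /boolean_intensity mule_ge0// lee_fin. Qed.

Lemma boolean_intensity_lty n (nu : probability R R) (lambda a : R)
  (I : set R) : 0 <= lambda -> 0 < a -> measurable I ->
  (boolean_intensity nu lambda ([set z : 'rV[R]_n | `|z| < a]%R `*` I) < +oo)%E.
Proof.
move=> l0 a0 mI; rewrite boolean_intensity_rect//; last exact: measurable_open_box.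
rewrite lebesgue_open_box// lte_mul_pinfty ?lee_fin// lte_mul_pinfty ?lee_fin//.
  by rewrite exprn_ge0// mulr_ge0// ltW.
by apply: le_lt_trans (probability_le1 _ _) _; rewrite ?ltry.
Qed.

End boxes.

(** * Finite-dimensional laws of the Poisson process *)

Lemma counting_eq0 (R : realType) (T : choiceType) (X : set T) :
  (counting X = 0 :> \bar R)%E <-> X = set0.
Proof.
rewrite /counting; case: ifPn => [/asboolP fX|/asboolPn nX]; last first.
  by split=> // X0; exfalso; apply: nX; rewrite X0; exact: finite_set0.
split=> [[/eqP]|->]; last by rewrite fset_set0.
rewrite pnatr_eq0 finmap.cardfs_eq0 => /eqP X0.
by rewrite -[X]fset_setK// X0; apply/seteqP; split.
Qed.

Lemma counting_le (R : realType) (T : choiceType) (X Y : set T) :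
  X `<=` Y -> (counting X <= counting Y :> \bar R)%E.
Proof.
move=> XY; rewrite {2}/counting; case: ifPn => [/asboolP fY|]; last by rewrite leey.
have fX := sub_finite_set XY fY.
rewrite /counting asboolT// lee_fin ler_nat.
by apply: finmap.fsubset_leq_card; rewrite -fset_set_sub.
Qed.

Lemma counting_ge0 (R : realType) (T : choiceType) (X : set T) :
  (0 <= counting X :> \bar R)%E.
Proof. by rewrite /counting; case: ifPn. Qed.

Lemma bigcap_fintype (T : Type) (I : finType) (F : I -> set T) :
  \bigcap_(i in [set: I]) F i = \bigcap_(k in [set: 'I_#|I|]) F (enum_val k).
Proof.
apply/seteqP; split=> [x xF k _|x xF i _]; first exact: xF.
by rewrite -(enum_rankK i); exact: xF.
Qed.

Section ppp.
Context {R : realType} (n : nat) {dO : measure_display}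
  {Omega : measurableType dO} (P : probability Omega R).
Variables (xi : Omega -> set ('rV[R]_n * R)) (mu : set ('rV[R]_n * R) -> \bar R).
Hypothesis H : poisson_point_process P xi mu.
Hypothesis mu_ge0 : forall A, (0 <= mu A)%E.
Local Notation pt := ('rV[R]_n * R)%type.
Implicit Types (A : set pt).

Definition occupies A : set Omega := [set w | xi w `&` A !=set0].

Lemma occupiesE A : occupies A = npoints xi A @^-1` ~` [set 0%E].
Proof.
apply/seteqP; split=> w /=; rewrite /npoints counting_eq0.
  by move=> /set0P/eqP.
by move=> /eqP/set0P.
Qed.

Lemma voidE A : ~` occupies A = npoints xi A @^-1` [set 0%E].
Proof. by rewrite occupiesE preimage_setC setCK. Qed.

Lemma measurable_occupies A : measurable A -> measurable (occupies A).
Proof.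
move=> mA; rewrite occupiesE -[X in measurable X]setTI.
by apply: (ppp_measurable H mA) => //; exact: measurableC.
Qed.

Lemma prob_void A : measurable A -> (mu A < +oo)%E ->
  P (~` occupies A) = (expR (- fine (mu A)))%:E.
Proof.
move=> mA Afin; rewrite voidE (_ : _ @^-1` _ =
  [set w | npoints xi A w = 0%:R%:E]); last by [].
rewrite (ppp_poisson H)// /poisson_prob; case: ifPn => [m0|].
  by rewrite esum_set1 ?lee_fin ?poisson_pmf_ge0// /poisson_pmf m0 expr0 fact0
    invr1 !mul1r.
(* With zero mean, [poisson_prob] is the Dirac mass at 0, in agreement with [expR 0 = 1]. *)
rewrite -leNgt => m0; rewrite diracE mem_set//=.
have -> : fine (mu A) = 0 by apply/eqP; rewrite eq_le m0 fine_ge0.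
by rewrite oppr0 expR0.
Qed.

Lemma prob_occupies A : measurable A -> (mu A < +oo)%E ->
  P (occupies A) = (1 - expR (- fine (mu A)))%:E.
Proof.
move=> mA Afin; rewrite -[occupies A]setCK probability_setC.
  by rewrite prob_void// EFinB.
by apply: measurableC; exact: measurable_occupies.
Qed.

Lemma prob_occupies_le A : measurable A -> (P (occupies A) <= mu A)%E.
Proof.
move=> mA; have [Afin|] := ltP (mu A) +oo%E; last first.
  by rewrite leye_eq => /eqP ->; rewrite leey.
rewrite prob_occupies// -[leRHS]fineK ?ge0_fin_numE// lee_fin lerBlDr.
by rewrite -lerBlDl; have := expR_ge1Dx (- fine (mu A)); lra.
Qed.

Lemma npoints_independent (J : finType) (A : J -> set pt) (B : J -> set (\bar R)) :
  (forall i, measurable (A i)) -> trivIset setT A ->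
  (forall i, measurable (B i)) ->
  P (\bigcap_(i in [set: J]) (npoints xi (A i) @^-1` B i)) =
  (\prod_i P (npoints xi (A i) @^-1` B i))%E.
Proof.
move=> mA tA mB; rewrite bigcap_fintype.
rewrite (ppp_independent H (A := fun k : 'I_#|J| => A (enum_val k)))//.
  rewrite [RHS](reindex (@enum_val _ predT))/=; last first.
    by apply: onW_bij; exact: enum_val_bij.
  by apply: eq_bigr.
by move=> i j _ _ /(tA _ _ I I)/enum_val_inj.
Qed.

Definition pattern (J : finType) (A : J -> set pt) (w : Omega) : {ffun J -> bool} :=
  [ffun i => `[< occupies (A i) w >]].

(* [expR (- m i)] is the probability that the [i]-th set is void. *)
Definition pattern_prob (J : finType) (m : J -> R) (o : J -> bool) : R :=
  \prod_i (if o i then 1 - expR (- m i) else expR (- m i)).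

Lemma prob_pattern (J : finType) (A : J -> set pt) (o : {ffun J -> bool}) :
  (forall i, measurable (A i)) -> trivIset setT A ->
  (forall i, mu (A i) < +oo)%E ->
  P [set w | pattern A w = o] = (pattern_prob (fun i => fine (mu (A i))) o)%:E.
Proof.
move=> mA tA fA.
pose B i : set (\bar R) := if o i then ~` [set 0%E] else [set 0%E].
have -> : [set w | pattern A w = o] =
    \bigcap_(i in [set: J]) (npoints xi (A i) @^-1` B i).
  apply/seteqP; split=> [w ow i _|w wB].
    rewrite /= /B -ow ffunE; case: asboolP.
      by rewrite -[X in X -> _]/(occupies _ w) occupiesE.
    by rewrite -[X in X -> _]/((~` occupies _) w) voidE.
  apply/ffunP => i; rewrite ffunE; have := wB i I; rewrite /B.
  case: (o i) => /=.
    by rewrite -[X in X -> _]/((npoints xi (A i) @^-1` ~` [set 0%E]) w)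
      -occupiesE => ?; rewrite asboolT.
  by rewrite -[X in X -> _]/((npoints xi (A i) @^-1` [set 0%E]) w) -voidE
    => ?; rewrite asboolF.
rewrite npoints_independent//; last first.
  by move=> i; rewrite /B; case: (o i) => //; exact: measurableC.
rewrite /pattern_prob -prodEFin; apply: eq_bigr => i _; rewrite /B.
case: (o i); first by rewrite -occupiesE prob_occupies.
by rewrite -voidE prob_void.
Qed.

Lemma measurable_pattern (J : finType) (A : J -> set pt)
    (F : {ffun J -> bool} -> Prop) : (forall i, measurable (A i)) ->
  measurable [set w | F (pattern A w)].
Proof.
move=> mA; have -> : [set w | F (pattern A w)] =
    \bigcup_(o in F) \bigcap_(i in [set: J])
      (if o i then occupies (A i) else ~` occupies (A i)).
  apply/seteqP; split=> [w Fw|w [q Fo wo]].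
    by exists (pattern A w) => // i _; rewrite ffunE; case: asboolP.
  suff -> : [set w | F (pattern A w)] w = F q by [].
  rewrite /=; congr F; apply/ffunP => i; rewrite ffunE.
  by have := wo i I; case: (q i) => /= ?; [rewrite asboolT|rewrite asboolF].
apply: fin_bigcup_measurable; first exact: finite_finset.
move=> o _; apply: fin_bigcap_measurable; first exact: finite_finset.
by move=> i _; case: (o i); [|apply: measurableC]; exact: measurable_occupies.
Qed.

Lemma prob_fibers (J : finType) (f : Omega -> J) (E : set Omega) :
  (forall j, measurable [set w | f w = j]) -> measurable E ->
  P E = (\sum_j P (E `&` [set w | f w = j]))%E.
Proof.
move=> mf mE; have fJ : finite_set [set: J] by exact: finite_finset.
have {1}-> : E = \bigcup_(j in [set: J]) (E `&` [set w | f w = j]).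
  by apply/seteqP; split=> [w Ew|w [j _ []]//]; exists (f w).
rewrite measure_fin_bigcup//.
- rewrite fsbig_finite//=; apply: perm_big.
  apply: uniq_perm; [exact: finmap.fset_uniq|exact: index_enum_uniq|].
  by move=> j; rewrite mem_index_enum in_fset_set//; apply: mem_set.
- by move=> i j _ _ [w [[_ <-] [_ <-]]].
- by move=> j _; exact: measurableI.
Qed.

End ppp.

Section pattern_events.
Context {R : realType} (n : nat) {dO : measure_display}
  {Omega : measurableType dO} (P : probability Omega R).
Variables (xi : Omega -> set ('rV[R]_n * R)) (mu : set ('rV[R]_n * R) -> \bar R).
Hypothesis H : poisson_point_process P xi mu.
Hypothesis mu_ge0 : forall A, (0 <= mu A)%E.
Local Notation pt := ('rV[R]_n * R)%type.
Local Notation mean A := (fun i => fine (mu (A i))).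

Lemma prob_pattern_event (J : finType) (A : J -> set pt)
    (F : {ffun J -> bool} -> Prop) :
  (forall i, measurable (A i)) -> trivIset setT A ->
  (forall i, mu (A i) < +oo)%E ->
  P [set w | F (pattern xi A w)] =
  (\sum_o if `[< F o >] then pattern_prob (mean A) o else 0)%:E.
Proof.
move=> mA tA fA.
rewrite (@prob_fibers _ _ _ P _ (pattern xi A)); last 2 first.
- by move=> o; exact: (measurable_pattern H (fun o' => o' = o) mA).
- exact: (measurable_pattern H).
rewrite -sumEFin; apply: eq_bigr => o _; case: asboolP => Fo.
  rewrite -(prob_pattern H)//; congr (P _).
  by apply/seteqP; split=> [w []//|w /= ow]; split=> //; rewrite /= ow.
rewrite (_ : _ `&` _ = set0) ?measure0//.
by apply/seteqP; split=> // w [/= + ow]; rewrite ow.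
Qed.

(** The law of an occupancy pattern is a function of the means alone; this compares grids centered
    at two different points. *)
Lemma prob_pattern_event_eq (J : finType) (A B : J -> set pt)
    (F : {ffun J -> bool} -> Prop) :
  (forall i, measurable (A i)) -> trivIset setT A ->
  (forall i, mu (A i) < +oo)%E ->
  (forall i, measurable (B i)) -> trivIset setT B ->
  (forall i, mu (A i) = mu (B i)) ->
  P [set w | F (pattern xi A w)] = P [set w | F (pattern xi B w)].
Proof.
move=> mA tA fA mB tB AB; have fB i : (mu (B i) < +oo)%E by rewrite -AB.
rewrite !prob_pattern_event//.
have -> // : mean A = mean B by apply/funext => i; rewrite AB.
Qed.

(** The two families together, indexed by [J + K], are again pairwise disjoint, so the pair of
    patterns is one pattern, whose probability factors over the sum type. *)
Lemma prob_pattern_eventI (J K : finType) (A : J -> set pt) (B : K -> set pt)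
    (F : {ffun J -> bool} -> Prop) (G : {ffun K -> bool} -> Prop) :
  (forall i, measurable (A i)) -> trivIset setT A ->
  (forall i, mu (A i) < +oo)%E ->
  (forall i, measurable (B i)) -> trivIset setT B ->
  (forall i, mu (B i) < +oo)%E ->
  (forall i j, A i `&` B j = set0) ->
  (P ([set w | F (pattern xi A w)] `&` [set w | G (pattern xi B w)]) =
   P [set w | F (pattern xi A w)] * P [set w | G (pattern xi B w)])%E.
Proof.
move=> mA tA fA mB tB fB AB.
pose C (s : J + K) := match s with inl i => A i | inr j => B j end.
have mC s : measurable (C s) by case: s.
have fC s : (mu (C s) < +oo)%E by case: s.
have tC : trivIset setT C.
  move=> [i|i] [j|j] _ _ /=.
  - by move=> /(tA _ _ I I) ->.
  - by rewrite AB => -[].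
  - by rewrite setIC AB => -[].
  - by move=> /(tB _ _ I I) ->.
pose join (o : {ffun J -> bool}) (q : {ffun K -> bool}) :
    {ffun (J + K)%type -> bool} :=
  [ffun s : J + K => match s with inl i => o i | inr j => q j end].
have joinP o q : [set w | pattern xi A w = o] `&` [set w | pattern xi B w = q] =
    [set w | pattern xi C w = join o q].
  apply/seteqP; split=> [w [/= <- <-]|w /= e].
    by apply/ffunP => -[i|i]; rewrite !ffunE.
  split=> /=; apply/ffunP => i.
    by have /ffunP/(_ (inl i)) := e; rewrite !ffunE.
  by have /ffunP/(_ (inr i)) := e; rewrite !ffunE.
have pjoin o q : pattern_prob (mean C) (join o q) =
    pattern_prob (mean A) o * pattern_prob (mean B) q.
  rewrite /pattern_prob big_sumType/=.
  by congr (_ * _); apply: eq_bigr => i _; rewrite !ffunE.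
set E := [set w | F _]; set E' := [set w | G _].
have mE : measurable E by exact: (measurable_pattern H F mA).
have mE' : measurable E' by exact: (measurable_pattern H G mB).
have mo o : measurable [set w | pattern xi A w = o].
  exact: (measurable_pattern H (fun o' => o' = o) mA).
have mq q : measurable [set w | pattern xi B w = q].
  exact: (measurable_pattern H (fun o' => o' = q) mB).
rewrite /E (prob_pattern_event F mA tA fA) -/E.
rewrite /E' (prob_pattern_event G mB tB fB) -/E'.
rewrite -EFinM mulr_suml -sumEFin.
rewrite (@prob_fibers _ _ _ P _ (pattern xi A))//; last exact: measurableI.
apply: eq_bigr => o _; rewrite mulr_sumr -sumEFin.
rewrite (@prob_fibers _ _ _ P _ (pattern xi B))//; last first.
  by apply: measurableI => //; exact: measurableI.
apply: eq_bigr => q _.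
(* Fixing both patterns decides both events, so the intersection is the whole fiber or is empty. *)
have -> : E `&` E' `&` [set w | pattern xi A w = o] `&`
    [set w | pattern xi B w = q] = if `[< F o >] && `[< G q >] then
      [set w | pattern xi C w = join o q] else set0.
  rewrite -setIA joinP; case: asboolP => Fo /=; last first.
    apply/seteqP; split=> // w [[Fw _]]; rewrite -joinP => -[/= ow _].
    by move: Fw; rewrite /E/= ow.
  case: asboolP => Gq /=; last first.
    apply/seteqP; split=> // w [[_ Gw]]; rewrite -joinP => -[_ /= qw].
    by move: Gw; rewrite /E'/= qw.
  apply: setIidr; rewrite -joinP => w [/= ow qw].
  by rewrite /E /E' /= ow qw.
case: asboolP => Fo /=; last by rewrite measure0 mul0r.
case: asboolP => Gq /=; last by rewrite measure0 mulr0.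
by rewrite (prob_pattern H)// pjoin.
Qed.

End pattern_events.

(** * Crossing events: measurability, stationarity, independence *)

Section eventually.
Context {R : realType} {dO : measure_display}
  {Omega : measurableType dO} (P : probability Omega R).
Variables (E : set Omega) (F : (set Omega)^nat).
Hypothesis mF : forall m, measurable (F m).
Hypothesis FE : forall m, F m `<=` E.
Hypothesis EF : forall w, E w -> exists m0, forall m, (m0 <= m)%N -> F m w.

(** Grids of successive meshes are not nested, so [F] need not be monotone; the intersections [D]
    are, and continuity from below applies to them. *)
Let D m := \bigcap_(k in [set k | (m <= k)%N]) F k.

Let mD m : measurable (D m).
Proof. by apply: bigcap_measurable; [exists m => /=|move=> k _; exact: mF]. Qed.

Let DE : \bigcup_m D m = E.
Proof.
apply/seteqP; split=> [w [m _ Dw]|w /EF[m0 m0P]].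
  by apply: (FE (m := m)); apply: Dw => /=.
by exists m0.
Qed.

Lemma measurable_eventually : measurable E.
Proof. by rewrite -DE; exact: bigcup_measurable. Qed.

Lemma cvg_eventually : P (F m) @[m --> \oo] --> P E.
Proof.
have cD : P (D m) @[m --> \oo] --> P E.
  rewrite -DE; apply: nondecreasing_cvg_mu => //.
    by rewrite DE; exact: measurable_eventually.
  move=> a b ab; apply/subsetPset => w Dw k /= bk.
  by apply: Dw => /=; exact: leq_trans bk.
apply: (squeeze_cvge _ cD (cvg_cst (P E))).
apply: nearW => m; apply/andP; split; apply: le_measure; rewrite ?inE//.
- by move=> w Dw; apply: Dw => /=.
- exact: measurable_eventually.
Qed.

End eventually.

Definition shift {R : realType} n (x : 'rV[R]_n) (S : set ('rV[R]_n * R)) :=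
  [set p : 'rV[R]_n * R | S (p.1 + x, p.2)].

Section crossing_events.
Context {R : realType} (n : nat) {dO : measure_display}
  {Omega : measurableType dO} (P : probability Omega R).
Variables (xi : Omega -> set ('rV[R]_n * R)) (nu : probability R R) (lambda : R).
Hypothesis lambda_ge0 : 0 <= lambda.
Hypothesis H : poisson_point_process P xi (boolean_intensity nu lambda).
Local Notation pt := ('rV[R]_n * R)%type.
Variables (U : set pt) (A B : set 'rV[R]_n).
Hypothesis oU : open U.

(* Measurability, stationarity and independence all come from approximating a
   crossing by events depending on the occupancies of finitely many cells of a
   grid centered at [x]. *)
Definition crossing x : set Omega :=
  [set w | crosses (shift x (xi w) `&` U) A B].

Let mu_ge0 (S : set pt) : (0 <= boolean_intensity nu lambda S)%E.
Proof. exact: boolean_intensity_ge0. Qed.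

(** Emptying the cells that stick out of [U] makes the pattern depend only on the points in the
    translate of [U] by [x]; disjoint translates then give disjoint cells. *)
Let ucell x m (i : cell_index n m) : set pt :=
  if `[< cell i `<=` U >] then shifted_cell x i else set0.

Let good m (o : {ffun cell_index n m -> bool}) := cell_crosses U A B (fun i => o i).

Let approx x m := [set w | good (pattern xi (@ucell x m) w)].

(** A cell chain only uses cells contained in [U], so the emptied cells never matter. *)
Let approxE x m w :
  approx x m w <-> cell_crosses U A B (@occupied _ _ (shift x (xi w)) m).
Proof.
have chg (occ occ' : cell_index n m -> Prop) i :
    (forall i, cell i `<=` U -> occ i -> occ' i) ->
    cell_chained U A occ i -> cell_chained U A occ' i.
  move=> oo; elim=> [{}i oi iUA|{}i j _ IH oj jU ij].
    by apply: cell_chained_first => //; apply: oo => // p /iUA[].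
  exact: cell_chained_next IH (oo _ jU oj) jU ij.
have occE i : cell i `<=` U ->
    (pattern xi (@ucell x m) w i <-> occupied (shift x (xi w)) i).
  move=> iU; rewrite ffunE /occupies /=.
  have -> : ucell x i = shifted_cell x i by rewrite /ucell asboolT.
  rewrite asboolE; split.
    move=> [p [wp ip]]; exists (p.1 - x, p.2); split; last exact: ip.
    by rewrite /shift/= subrK -surjective_pairing.
  move=> [p [wp ip]]; exists (p.1 + x, p.2); split; first exact: wp.
  by rewrite /shifted_cell/= addrK -surjective_pairing.
split=> -[i ic iB]; exists i => //; apply: chg ic => j jU.
  by rewrite occE.
by rewrite -occE.
Qed.

Let approx_crossing x m : approx x m `<=` crossing x.
Proof. by move=> w /approxE; exact: cell_crosses_crosses. Qed.

Let crossing_approx x w : crossing x w ->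
  exists m0, forall m, (m0 <= m)%N -> approx x m w.
Proof.
by move=> /(crosses_cell_crosses oU)[m0 m0P]; exists m0 => m /m0P/approxE.
Qed.

Let mcell x m (i : cell_index n m) : measurable (ucell x i).
Proof.
by rewrite /ucell; case: ifP => // _; exact: measurable_shifted_cell.
Qed.

Let fcell x m (i : cell_index n m) :
  (boolean_intensity nu lambda (ucell x i) < +oo)%E.
Proof.
rewrite /ucell; case: ifP => // _; last first.
  by rewrite /boolean_intensity measure0 mule0.
rewrite boolean_intensity_shifted_cell lte_mul_pinfty ?lee_fin//.
rewrite lte_mul_pinfty ?lee_fin ?exprn_ge0 ?invr_ge0//.
by apply: le_lt_trans (probability_le1 _ _) _; rewrite ?ltry//; exact: measurable_slot.
Qed.

Let tcell x m : trivIset setT (@ucell x m).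
Proof.
move=> i j _ _ [p []]; rewrite /ucell; case: ifP => // _; case: ifP => // _.
by rewrite /shifted_cell/=; exact: cell_inj.
Qed.

Let mapprox x m : measurable (approx x m).
Proof. by apply: (measurable_pattern H); exact: mcell. Qed.

Lemma measurable_crossing x : measurable (crossing x).
Proof.
exact: (measurable_eventually (mapprox x) (@approx_crossing x) (@crossing_approx x)).
Qed.

Let cvg_crossing x : P (approx x m) @[m --> \oo] --> P (crossing x).
Proof.
exact: (cvg_eventually (mapprox x) (@approx_crossing x) (@crossing_approx x)).
Qed.

(** At each mesh the cells centered at [x] and at [y] have equal means, so the approximations have
    equal probabilities, and so do their limits. *)
Lemma prob_crossing_shift x y : P (crossing x) = P (crossing y).
Proof.
suff e : (fun m => P (approx x m)) = (fun m => P (approx y m)).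
  by have := @cvg_crossing y; rewrite -e => /(cvg_unique _ (@cvg_crossing x)) ->.
apply/funext => m; apply: (prob_pattern_event_eq H mu_ge0).
- exact: mcell.
- exact: tcell.
- exact: fcell.
- exact: mcell.
- exact: tcell.
- move=> i; rewrite /ucell; case: ifP => _; last by [].
  rewrite (boolean_intensity_shifted_cell nu lambda x).
  by rewrite (boolean_intensity_shifted_cell nu lambda y).
Qed.

(** Disjointness of the two translates of [U] passes to the cells, so independence holds exactly at
    each mesh and survives in the limit. *)
Lemma prob_crossingI x y :
  (forall p q, U p -> U q -> p.1 + x <> q.1 + y) ->
  (P (crossing x `&` crossing y) = P (crossing x) * P (crossing y))%E.
Proof.
move=> dU.
have c1 : P (approx x m `&` approx y m) @[m --> \oo] -->
    P (crossing x `&` crossing y).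
  apply: cvg_eventually => [m|m|w [/crossing_approx[m1 h1] /crossing_approx[m2 h2]]].
  - exact: measurableI.
  - by apply: setISS; exact: approx_crossing.
  - exists (maxn m1 m2) => m; rewrite geq_max => /andP[a b].
    by split; [exact: h1|exact: h2].
have c2 : (P (approx x m) * P (approx y m))%E @[m --> \oo] -->
    (P (crossing x) * P (crossing y))%E.
  apply: cvgeM; [|exact: cvg_crossing|exact: cvg_crossing].
  by rewrite mule_def_fin// fin_num_measure//; exact: measurable_crossing.
have e : (fun m => P (approx x m `&` approx y m)) =
    (fun m => P (approx x m) * P (approx y m))%E.
  apply/funext => m; apply: (prob_pattern_eventI H mu_ge0).
  - exact: mcell.
  - exact: tcell.
  - exact: fcell.
  - exact: mcell.
  - exact: tcell.
  - exact: fcell.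
  move=> i j; apply/seteqP; split=> // p []; rewrite /ucell.
  case: asboolP => // iU; case: asboolP => // jU.
  move=> /iU + /jU.
  by move=> /dU/[apply]/=; rewrite !subrK.
by rewrite e in c1; exact: cvg_unique c1 c2.
Qed.

End crossing_events.

(** * Crossings at successive scales *)

Section scales.
Context {R : realType} (n : nat).
Hypothesis n_ge2 : (2 <= n)%N.
Local Notation pt := ('rV[R]_n * R)%type.
Implicit Types (S : set pt) (A B : set 'rV[R]_n) (p q : pt) (a : R).

(* A crossing at scale [a] runs from the box of radius [a] out of the box of
   radius [out_ratio * a], using centers in the box of radius [ctr_ratio * a];
   [scale] is the ratio of consecutive scales. *)
Definition out_ratio : R := 2 * n%:R.
Definition ctr_ratio : R := 2 * n%:R + 2.
Definition scale : nat := (4 * n + 8)%N.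

Definition inner a : set 'rV[R]_n := [set z | `|z| <= a].
Definition outer a : set 'rV[R]_n := [set z | out_ratio * a < `|z|].
Definition window a : set pt := [set p | `|p.1| < ctr_ratio * a].

Let n_ge2R : 2 <= n%:R :> R.
Proof. by rewrite ler_nat. Qed.

Lemma scaleE : scale%:R = 4 * n%:R + 8 :> R.
Proof. by rewrite /scale natrD natrM. Qed.

Lemma scale_gt1 : 1 < scale%:R :> R.
Proof.
have n2 := n_ge2R; by rewrite scaleE; lra. Qed.

Lemma scaleX_gt0 k : 0 < scale%:R ^+ k :> R.
Proof. by rewrite exprn_gt0// (lt_trans _ scale_gt1). Qed.

Lemma open_window a : open (window a).
Proof.
have -> : window a = (fun p : pt => `|p.1|) @^-1` [set y | y < ctr_ratio * a].
  by [].
apply: open_comp; last exact: open_lt.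
move=> p _; apply: (@continuous_comp _ _ _ (fst : pt -> _) Num.norm).
  exact: cvg_fst.
exact: norm_continuous.
Qed.

Lemma eball_norm_center p z : eball p.1 p.2 z -> `|p.1 - z| < p.2.
Proof. by rewrite distrC; exact: eball_norm. Qed.

Lemma hits_radius_gt0 A p : hits A p -> 0 < p.2.
Proof. by move=> [z [/eball_radius_gt0]]. Qed.

(** Consecutive centers are less than [2 * a] apart, so a chain cannot jump over a shell of that
    width; it can be restarted from a center found there. *)
Lemma chained_split S A rho a p : (forall q, S q -> q.2 < a) ->
  (forall q, S q -> hits A q -> `|q.1| < rho) ->
  chained S A p -> rho <= `|p.1| ->
  exists q, [/\ S q, rho <= `|q.1| < rho + 2 * a & chained S [set q.1] p].
Proof.
move=> Sa SA; elim=> [{}p Sp pA|{}p q pS IH Sq [z [qz pz]]] rp.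
  by have := SA p Sp pA; rewrite ltNge rp.
have [/IH[q0 [Sq0 q0r q0p]]|pr] := leP rho `|p.1|.
  by exists q0; split=> //; apply: chained_next q0p Sq _; exists z.
exists q; split=> //.
  rewrite rp/=; have qa := Sa q Sq; have pa := Sa p (chained_in pS).
  have zq := eball_norm_center qz; have zp := eball_norm pz.
  have : `|q.1| <= `|q.1 - z| + `|z - p.1| + `|p.1|.
    have {1}-> : q.1 = (q.1 - z) + (z - p.1) + p.1 by rewrite addrA subrK subrK.
    by rewrite (le_trans (ler_normD _ _))// lerD2r ler_normD.
  by move: zq zp pr qa pa; lra.
apply: chained_first => //; exists q.1; split=> //.
exact: eball_center (eball_radius_gt0 qz).
Qed.

Lemma chained_shift S A x p : chained S A p ->
  chained (shift x S) [set z | A (z + x)] (p.1 - x, p.2).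
Proof.
have sh (c z : 'rV[R]_n) r : eball c r z -> eball (c - x) r (z - x).
  by rewrite /eball/= opprB addrA subrK.
have Ssh q : S q -> shift x S (q.1 - x, q.2).
  by rewrite /shift/= subrK -surjective_pairing.
elim=> [{}p Sp [z [pz Az]]|{}p q _ IH Sq [z [qz pz]]].
  apply: chained_first; first exact: Ssh.
  by exists (z - x); split; [exact: sh|rewrite /= subrK].
apply: (chained_next IH); first exact: Ssh.
by exists (z - x); split; exact: sh.
Qed.

(** The chain is cut at the first ball that leaves the box of radius [out_ratio * a] around [x]; up
    to and including that ball, every ball meets the box and is thus centered in the window. *)
Lemma chained_crosses S x a y p : 0 < a -> `|y - x| <= a ->
  (forall q z, S q -> eball q.1 q.2 z -> `|z - x| <= out_ratio * a ->
     `|q.1 - x| < ctr_ratio * a) ->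
  chained S [set y] p ->
  hits [set z | out_ratio * a < `|z - x|] p ->
  crosses (shift x S `&` window a) (inner a) (outer a).
Proof.
have n2 := n_ge2R.
move=> a0 yx Sloc pS pout.
pose V : set pt := [set q | forall z, eball q.1 q.2 z -> `|z - x| <= out_ratio * a].
have ya : `|y - x| <= out_ratio * a.
  by apply: le_trans yx _; rewrite /out_ratio; nra.
have move_chain q : chained (S `&` V `&` [set q | `|q.1 - x| < ctr_ratio * a])
    [set y] q ->
    chained (shift x S `&` window a) (inner a) (q.1 - x, q.2).
  move=> /(chained_shift x); apply: chained_sub.
    move=> r [[]]; rewrite /shift/= => Sr _; rewrite addrK => rx.
    by split.
  by move=> z /= zy; rewrite /inner/= -(addrK x z) zy.
have locV q : chained (S `&` V) [set y] q ->
    chained (S `&` V `&` [set q | `|q.1 - x| < ctr_ratio * a]) [set y] q.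
  elim=> [{}q [Sq Vq] qy|{}q q' _ IH [Sq' Vq'] qq'].
    apply: chained_first => //; split=> //=.
    by have [z [qz _]] := qy; exact: (Sloc q z Sq qz (Vq z qz)).
  apply: (chained_next IH) => //; split=> //=.
  by have [z [qz _]] := qq'; exact: (Sloc q' z Sq' qz (Vq' z qz)).
case: (chained_exit V pS) => [/chained_in[_ Vp]|].
  have [z [pz /= zout]] := pout.
  by have := Vp z pz; rewrite leNgt zout.
move=> [q [Sq nVq qstart]].
have [z qz zout] : exists2 z, eball q.1 q.2 z & out_ratio * a < `|z - x|.
  apply: contrapT => nz; apply: nVq => z qz; rewrite leNgt.
  by apply/negP => zout; apply: nz; exists z.
(* The exit ball still meets the box, at [y] or at a point of a ball of [V], so [Sloc] applies to
   it. *)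
have qx : `|q.1 - x| < ctr_ratio * a.
  case: qstart => [[z' [qz' zy]]|[q' /chained_in[_ Vq'] [z' [qz' q'z']]]].
    by apply: (Sloc q z') => //; rewrite zy.
  exact: (Sloc q z' Sq qz' (Vq' z' q'z')).
exists (q.1 - x, q.2).
  case: qstart => [qy|[q' /locV/move_chain q'c [z' [qz' q'z']]]].
    have : chained (S `&` [set q | `|q.1 - x| < ctr_ratio * a]) [set y] q.
      by apply: chained_first.
    move=> /(chained_shift x); apply: chained_sub.
      by move=> r []; rewrite /shift/= => Sr; rewrite addrK.
    by move=> z' /= zy; rewrite /inner/= -(addrK x z') zy.
  apply: (chained_next q'c).
    by split=> //; rewrite /shift/= subrK -surjective_pairing.
  exists (z' - x); split; first by move: qz'; rewrite /eball/= opprB addrA subrK.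
  by move: q'z'; rewrite /eball/= opprB addrA subrK.
by exists (z - x); split => //=; move: qz; rewrite /eball/= opprB addrA subrK.
Qed.

(** The lower bound on [rho] puts the first centers inside the shell and the upper bound puts the
    last one beyond it. The chain restarted in the shell still has to travel far, hence leaves the
    small box around any [x] close to the restarting center. *)
Lemma crosses_rescale S a rho : 0 < a ->
  (forall q, S q -> q.2 < a) ->
  scale%:R * a + a <= rho -> rho <= 3 * scale%:R * a ->
  crosses S (inner (scale%:R * a)) (outer (scale%:R * a)) ->
  exists q, [/\ S q, rho <= `|q.1| < rho + 2 * a &
    forall x, `|q.1 - x| <= a ->
      crosses (shift x S `&` window a) (inner a) (outer a)].
Proof.
have n2 := n_ge2R.
move=> a0 Sa rho1 rho3 [p pS [z [pz zout]]].
have h1 : 2 * a <= n%:R * a by rewrite ler_wpM2r// ltW.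
have h2 : 2 * (n%:R * a) <= n%:R * (n%:R * a).
  by rewrite ler_wpM2r// mulr_ge0// ltW.
have Sp := chained_in pS; have pa := Sa p Sp.
have pz' := eball_norm pz; move: zout; rewrite /outer/= => zout.
have pbig : out_ratio * (scale%:R * a) - a < `|p.1|.
  have : `|z| <= `|z - p.1| + `|p.1| by rewrite -{1}(subrK p.1 z) ler_normD.
  by move: zout pz' pa; lra.
have [||q [Sq qr qp]] := @chained_split S (inner (scale%:R * a)) rho a p Sa _ pS.
- move=> q Sq [y [qy]]; rewrite /inner/= => yin.
  have := eball_norm_center qy; have := Sa q Sq.
  have : `|q.1| <= `|q.1 - y| + `|y| by rewrite -{1}(subrK y q.1) ler_normD.
  by move: yin rho1; lra.
- apply: le_trans rho3 _; apply/ltW; apply: le_lt_trans pbig.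
  by rewrite /out_ratio scaleE; nra.
exists q; split=> // x qx; apply: (chained_crosses a0 qx) qp _.
  move=> r y Sr ry yx; have := eball_norm_center ry; have := Sa r Sr.
  have : `|r.1 - x| <= `|r.1 - y| + `|y - x|.
    have {1}-> : r.1 - x = (r.1 - y) + (y - x) by rewrite addrA subrK.
    exact: ler_normD.
  by move: yx; rewrite /out_ratio /ctr_ratio; lra.
exists p.1; split; first exact: eball_center (eball_radius_gt0 pz).
have : `|p.1| <= `|p.1 - x| + `|q.1 - x| + `|q.1|.
  have {1}-> : p.1 = (p.1 - x) + (x - q.1) + q.1 by rewrite addrA subrK subrK.
  by rewrite (distrC q.1) (le_trans (ler_normD _ _))// lerD2r ler_normD.
case/andP: qr => _ qr; move: pbig qr qx rho3 => /=; rewrite /out_ratio scaleE.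
by nra.
Qed.

(** The centers to be rounded have norm below [3 * scale * a + 2 * a]. The mesh has step [a], so the
    number of its points is the same at all scales. *)
Definition mesh_size : nat := (3 * scale + 3)%N.
Definition mesh_index : finType := {ffun 'I_n -> 'I_(2 * mesh_size + 1)}.
Definition mesh_point a (g : mesh_index) : 'rV[R]_n :=
  \row_j (a * ((g j)%:R - mesh_size%:R)).

Lemma mesh_pointP a (c : 'rV[R]_n) : 0 < a -> `|c| <= mesh_size%:R * a ->
  exists g, `|c - mesh_point a g| <= a.
Proof.
move=> a0 ca.
have one (y : R) : `|y| <= mesh_size%:R * a ->
    exists k : 'I_(2 * mesh_size + 1), `|y - a * (k%:R - mesh_size%:R)| <= a.
  rewrite ler_norml => /andP[y1 y2].
  set t := y / a + mesh_size%:R.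
  have yE : y = (t - mesh_size%:R) * a.
    by rewrite /t addrK divfK// gt_eqF.
  have t0 : 0 <= t by move: y1; rewrite yE; nra.
  have tM : (Num.trunc t < 2 * mesh_size + 1)%N.
    rewrite -(ltr_nat R); apply: le_lt_trans (proj1 (andP (truncn_itv t0))) _.
    by move: y2; rewrite yE natrD natrM; nra.
  exists (Ordinal tM) => /=.
  have /andP[] := truncn_itv t0; set k := Num.trunc t => k1.
  rewrite -[k.+1]addn1 natrD => k2.
  by rewrite yE ler_norml; apply/andP; split; nra.
have [g gP] : exists g : mesh_index, forall j,
    `|c ord0 j - a * ((g j)%:R - mesh_size%:R)| <= a.
  have cj j : exists k : 'I_(2 * mesh_size + 1),
      `|c ord0 j - a * (k%:R - mesh_size%:R)| <= a.
    by apply: one; apply: le_trans ca; exact: norm_coord_le.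
  exists [ffun j => projT1 (cid (cj j))] => j; rewrite ffunE.
  by case: cid.
exists g; apply: norm_rV_le; first exact: ltW.
by move=> j; rewrite !mxE; exact: gP.
Qed.

Definition far_mesh a (gh : mesh_index * mesh_index) : bool :=
  2 * (ctr_ratio * a) <= `|mesh_point a gh.1 - mesh_point a gh.2|.

Lemma far_mesh_window a gh p q : far_mesh a gh -> window a p -> window a q ->
  p.1 + mesh_point a gh.1 <> q.1 + mesh_point a gh.2.
Proof.
have n2 := n_ge2R.
rewrite /far_mesh /window/= => gh_far pw qw e.
have : `|mesh_point a gh.1 - mesh_point a gh.2| = `|q.1 - p.1|.
  by congr (`| _ |); apply/eqP; rewrite subr_eq addrAC -e addrAC subrr add0r.
have := ler_normB q.1 p.1; move: gh_far pw qw; lra.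
Qed.

(** The large crossing meets the shells starting at radii [2 * scale * a] and [3 * scale * a], and
    produces a small crossing from each. Rounding to the mesh leaves finitely many possible pairs
    for a union bound. *)
Lemma crosses_double S a : 0 < a -> (forall q, S q -> q.2 < a) ->
  crosses S (inner (scale%:R * a)) (outer (scale%:R * a)) ->
  exists2 gh, far_mesh a gh &
    crosses (shift (mesh_point a gh.1) S `&` window a) (inner a) (outer a) /\
    crosses (shift (mesh_point a gh.2) S `&` window a) (inner a) (outer a).
Proof.
have n2 := n_ge2R.
move=> a0 Sa SX.
have h1 : 2 * a <= n%:R * a by rewrite ler_wpM2r// ltW.
have h2 : 2 * (n%:R * a) <= n%:R * (n%:R * a).
  by rewrite ler_wpM2r// mulr_ge0// ltW.
have [||q1 [Sq1 /andP[q1a q1b] q1x]] :=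
  @crosses_rescale S a (2 * scale%:R * a) a0 Sa _ _ SX.
- by rewrite scaleE; nra.
- by rewrite scaleE; nra.
have [||q2 [Sq2 /andP[q2a q2b] q2x]] :=
  @crosses_rescale S a (3 * scale%:R * a) a0 Sa _ _ SX.
- by rewrite scaleE; nra.
- by rewrite scaleE; nra.
have mE : mesh_size%:R = 3 * scale%:R + 3 :> R by rewrite /mesh_size natrD natrM.
have [|g1 g1P] := @mesh_pointP a q1.1 a0.
  by move: q1b; rewrite mE scaleE; nra.
have [|g2 g2P] := @mesh_pointP a q2.1 a0.
  by move: q2b; rewrite mE scaleE; nra.
exists (g1, g2); last by split; [exact: q1x|exact: q2x].
rewrite /far_mesh/=.
set x1 := mesh_point a g1; set x2 := mesh_point a g2.
have : `|q2.1| <= `|q2.1 - x2| + `|x1 - x2| + `|q1.1 - x1| + `|q1.1|.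
  have {1}-> : q2.1 = (q2.1 - x2) + (x2 - x1) + (x1 - q1.1) + q1.1.
    by rewrite !addrA !subrK.
  rewrite (distrC x1 x2) (distrC q1.1 x1).
  rewrite (le_trans (ler_normD _ _))// lerD2r.
  by rewrite (le_trans (ler_normD _ _))// lerD2r ler_normD.
(* The norms of the centers differ by more than [scale * a - 2 * a]; the two roundings leave
   [scale * a - 4 * a], which is exactly [2 * ctr_ratio * a]. *)
move: q1b q2a; rewrite -/x1 -/x2 in g1P g2P *; move: g1P g2P.
by rewrite /ctr_ratio scaleE; lra.
Qed.

(** Passage from clusters to scales: when large balls are centered far away in proportion to their
    radii, only balls centered in the window can meet the box. *)
Lemma cluster_crosses S a y : 0 < a ->
  (forall q, S q -> a <= q.2 -> ctr_ratio * q.2 <= `|q.1|) ->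
  origin_cluster S y -> out_ratio * a < `|y| ->
  crosses (S `&` window a) (inner a) (outer a).
Proof.
have n2 := n_ge2R.
move=> a0 nobad /origin_cluster_chained[p p0 py] yout.
have := @chained_crosses S 0 a 0 p a0; rewrite subr0 normr0 => /(_ (ltW a0)).
have -> : shift 0 S = S.
  by apply/seteqP; split=> -[c r]; rewrite /shift/= addr0.
apply=> //; last by exists y; rewrite /= subr0.
move=> q z Sq qz; rewrite !subr0 => zin.
(* A radius of at least [2 * a] is impossible: the center would have norm at least
   [ctr_ratio * q.2], and the ball would miss the box of radius [out_ratio * a]. *)
have [qa|qa] := ltP q.2 (2 * a); last first.
  have aq : a <= q.2 by move: qa a0; lra.
  have cq := nobad q Sq aq.
  have := eball_norm_center qz.
  have : `|q.1| <= `|q.1 - z| + `|z| by rewrite -{1}(subrK z q.1) ler_normD.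
  move: zin cq qa; rewrite /out_ratio /ctr_ratio; nra.
have := eball_norm_center qz.
have : `|q.1| <= `|q.1 - z| + `|z| by rewrite -{1}(subrK z q.1) ler_normD.
by move: zin; rewrite /out_ratio /ctr_ratio; lra.
Qed.

End scales.

(** * Moments and weighted series *)

(** The integral of a nonnegative function is a supremum over the simple functions below it, hence
    monotone on arbitrary functions. The cluster moments are compared with series in this way. *)
Lemma ge0_le_lower_integral d (T : measurableType d) (R : realType)
    (mu : {measure set T -> \bar R}) (f g : T -> \bar R) :
  (forall x, 0 <= f x)%E -> (forall x, f x <= g x)%E ->
  (\int[mu]_x f x <= \int[mu]_x g x)%E.
Proof.
move=> f0 fg; rewrite !ge0_integralTE//; last first.
  by move=> x; exact: le_trans (fg x).
apply: ereal_sup_le => _ [h hf <-]; exists h => // x.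
exact: le_trans (hf x) (fg x).
Qed.

Section series_bounds.
Context {R : realType}.
Implicit Types (u v : nat -> R).

Lemma nneseries_le_partial (u : nat -> \bar R) (M : \bar R) :
  (forall k, 0 <= u k)%E -> (forall N, \sum_(0 <= k < N) u k <= M)%E ->
  (\sum_(k <oo) u k <= M)%E.
Proof.
move=> u0 uM; apply: lime_le; first exact: is_cvg_nneseries.
exact: nearW.
Qed.

Lemma geometric_sum_le (b : R) k : 1 < b ->
  \sum_(0 <= j < k.+1) b ^+ j <= b / (b - 1) * b ^+ k.
Proof.
move=> b1; have b1' : 0 < b - 1 by rewrite subr_gt0.
rewrite big_mkord mulrAC ler_pdivlMr// mulrC -subrX1 exprS; lra.
Qed.

Lemma nneseries_expr_infty (b : R) : 1 <= b ->
  (\sum_(k <oo) (b ^+ k)%:E = +oo)%E.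
Proof.
move=> b1; apply/eqyP => A A0; pose N := (Num.trunc A).+1.
apply: le_trans (nneseries_lim_ge N _); last first.
  by move=> k _ _; rewrite lee_fin exprn_ge0// (le_trans _ b1).
rewrite sumEFin lee_fin; apply: (@le_trans _ _ N%:R); first exact/ltW/truncnS_gt.
rewrite big_mkord -[X in X%:R]card_ord -sum1_card natr_sum.
by apply: ler_sum => k _; exact: exprn_ege1.
Qed.

(** By smallness, [C * x j ^+ 2] is at most [x j / (2 * b)], so each weighted term is at most half
    the previous one plus [b] times a weighted [delta]. A partial sum [S] then satisfies
    [S <= x 0 + S / 2 + b * D]. *)
Lemma quadratic_recursion (b C : R) (x delta : nat -> R) (D : R) : 1 < b ->
  (forall j, 0 <= x j) -> (forall j, C * x j <= (2 * b)^-1) ->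
  (forall j, x j.+1 <= C * x j ^+ 2 + delta j) ->
  (forall N, \sum_(0 <= j < N) b ^+ j * delta j <= D) ->
  forall N, \sum_(0 <= j < N) b ^+ j * x j <= 2 * (x 0%N + b * D).
Proof.
move=> b1 x0 Cx xS dD N; have b0 : 0 < b by apply: lt_trans b1.
have half j : b ^+ j.+1 * x j.+1 <= 2^-1 * (b ^+ j * x j) + b * (b ^+ j * delta j).
  have -> : 2^-1 * (b ^+ j * x j) + b * (b ^+ j * delta j) =
      b ^+ j.+1 * ((2 * b)^-1 * x j + delta j).
    by rewrite exprS; field; rewrite gt_eqF.
  rewrite ler_pM2l ?exprn_gt0//; apply: le_trans (xS j) _.
  by rewrite lerD2r expr2 mulrA ler_wpM2r.
have {}dD M : \sum_(0 <= j < M) b ^+ j * delta j <= D := dD M.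
suff SN : \sum_(0 <= j < N.+1) b ^+ j * x j <= 2 * (x 0%N + b * D).
  apply: le_trans SN; rewrite big_nat_recr//= lerDl mulr_ge0// exprn_ge0//.
  exact: ltW.
have S0 : 0 <= \sum_(0 <= j < N) b ^+ j * x j.
  by apply: sumr_ge0 => j _; rewrite mulr_ge0// exprn_ge0// ltW.
have : \sum_(0 <= j < N.+1) b ^+ j * x j <=
    x 0%N + 2^-1 * \sum_(0 <= j < N) b ^+ j * x j + b * D.
  rewrite big_nat_recl// expr0 mul1r -addrA lerD2l.
  apply: (@le_trans _ _ (\sum_(0 <= j < N)
    (2^-1 * (b ^+ j * x j) + b * (b ^+ j * delta j)))); first exact: ler_sum.
  by rewrite big_split/= -!mulr_sumr lerD2l ler_wpM2l ?dD// ltW.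
have : \sum_(0 <= j < N) b ^+ j * x j <= \sum_(0 <= j < N.+1) b ^+ j * x j.
  by rewrite [leRHS]big_nat_recr//= lerDl mulr_ge0// exprn_ge0// ltW.
lra.
Qed.

(** After exchanging the sums, [v k] carries the weight [1 + b + ... + b ^ k], a geometric sum
    dominated by its last term. *)
Lemma weighted_tails (b : R) (v : nat -> \bar R) : 1 < b ->
  (forall k, 0 <= v k)%E ->
  (\sum_(j <oo) (b ^+ j)%:E * \sum_(k <oo) (if (j <= k)%N then v k else 0) <=
   (b / (b - 1))%:E * \sum_(k <oo) (b ^+ k)%:E * v k)%E.
Proof.
move=> b1 v0; have b0 : 0 <= b by apply/ltW; apply: lt_trans b1.
have w0 j k : (0 <= if (j <= k)%N then v k else 0)%E by case: ifP.
under eq_eseriesr do rewrite -nneseriesZl//.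
rewrite nneseries_interchange; last first.
  by move=> j k; rewrite mule_ge0// lee_fin exprn_ge0.
rewrite -nneseriesZl; last first.
  by move=> k _; rewrite mule_ge0// lee_fin exprn_ge0.
apply: lee_nneseries => [k _ _|k _].
  by apply: nneseries_ge0 => j _ _; rewrite mule_ge0// lee_fin exprn_ge0.
apply: nneseries_le_partial => [j|N].
  by rewrite mule_ge0// lee_fin exprn_ge0.
apply: (@le_trans _ _ (\sum_(0 <= j < k.+1) (b ^+ j)%:E * v k)%E).
  rewrite (eq_bigr (fun j => if (j <= k)%N then (b ^+ j)%:E * v k else 0)%E).
    have a0 j : (0 <= (b ^+ j)%:E * v k)%E by rewrite mule_ge0// lee_fin exprn_ge0.
    have [Nk|kN] := leqP N k.+1.
      rewrite big_nat_cond (eq_bigr (fun j => (b ^+ j)%:E * v k)%E).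
        by rewrite -big_nat_cond; apply: lee_sum_nneg_natr.
      by move=> j /andP[/andP[_ jN] _]; rewrite -ltnS (leq_trans jN).
    rewrite (big_cat_nat (n := k.+1))//= ?(ltnW kN)//.
    rewrite [X in (_ + X)%E]big_nat_cond [X in (_ + X)%E]big1 ?adde0.
      rewrite big_nat_cond [leRHS]big_nat_cond; apply: lee_sum => j.
      by move=> /andP[/andP[_ jk] _]; rewrite -ltnS jk.
    by move=> j /andP[/andP[kj _] _]; rewrite leqNgt kj.
  by move=> j _; case: ifP => // _; rewrite mule0.
rewrite -ge0_sume_distrl; last by move=> j _; rewrite lee_fin exprn_ge0.
rewrite sumEFin muleA -EFinM lee_wpmul2r// lee_fin.
exact: geometric_sum_le.
Qed.

End series_bounds.

Section moment_bounds.
Context {R : realType} {dO : measure_display} {Omega : measurableType dO}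
  (P : probability Omega R).
Implicit Types (X : Omega -> \bar R) (E : (set Omega)^nat).

Let measurable_term (c : R) (E : set Omega) : measurable E ->
  measurable_fun setT (fun w => (c * \1_E w)%:E).
Proof.
by move=> mE; apply/measurable_EFinP; exact: measurable_funM.
Qed.

Let integral_term (c : R) (E : set Omega) : 0 <= c -> measurable E ->
  (\int[P]_w (c * \1_E w)%:E = c%:E * P E)%E.
Proof.
move=> c0 mE; under eq_integral do rewrite EFinM.
rewrite ge0_integralZl_EFin//.
- by rewrite integral_indic// setIT.
- by apply/measurable_EFinP; exact: measurable_indic.
Qed.

(** Let [j] be the first index with [w] outside [E j]. Either [j = 0] and [X w <= M], or [w] lies in
    the preceding event, whose term in the series already dominates [X w]; if there is no such [j],
    the series is infinite. *)
Lemma integral_upper X E (b M : R) : 1 < b -> 0 < M ->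
  (forall w, 0 <= X w)%E -> (forall j, measurable (E j)) ->
  (forall j w, ~ E j w -> X w <= (M * b ^+ j)%:E)%E ->
  (\sum_(j <oo) (b ^+ j)%:E * P (E j) < +oo)%E -> (\int[P]_w X w < +oo)%E.
Proof.
move=> b1 Mgt0 X0 mE XE sumE; have M0 := ltW Mgt0.
have b0 : 0 <= b by apply/ltW; apply: lt_trans b1.
have bj j : 0 <= b ^+ j by exact: exprn_ge0.
pose f j w := (b ^+ j * \1_(E j) w)%:E : \bar R.
have f0 j w : (0 <= f j w)%E by rewrite lee_fin mulr_ge0.
have mf j : measurable_fun setT (f j) by exact: measurable_term.
have mS : measurable_fun setT (fun w => \sum_(j <oo) f j w)%E.
  by apply: ge0_emeasurable_sum.
apply: (@le_lt_trans _ _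
  (\int[P]_w (M%:E + (M * b)%:E * \sum_(j <oo) f j w))%E).
  apply: ge0_le_lower_integral => // w.
  have [[j0 nE]|allE] := pselect (exists j, ~ E j w); last first.
    have Ew j : E j w by apply: contrapT => nE; apply: allE; exists j.
    have -> : (\sum_(j <oo) f j w = +oo)%E.
      rewrite -(nneseries_expr_infty (ltW b1)); apply: eq_eseriesr => j _.
      by rewrite /f indicE mem_set// mulr1.
    by rewrite gt0_muley ?addey ?leey// lte_fin mulr_gt0// (lt_trans _ b1).
  have ex : exists j, `[< ~ E j w >] by exists j0; apply/asboolP.
  case: (ex_minnP ex) => -[|j] /asboolP nEj jmin.
    apply: le_trans (XE _ _ nEj) _; rewrite expr0 mulr1 leeDl// mule_ge0//.
      by rewrite lee_fin mulr_ge0.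
    exact: nneseries_ge0.
  have Ej : E j w.
    by apply: contrapT => /asboolP /jmin; rewrite ltnn.
  apply: le_trans (XE _ _ nEj) _.
  apply: (@le_trans _ _ ((M * b)%:E * f j w)%E).
    by rewrite /f indicE mem_set// mulr1 -EFinM lee_fin exprS mulrA.
  rewrite -[leLHS]add0e leeD ?lee_fin// lee_wpmul2l ?lee_fin ?mulr_ge0//.
  apply: le_trans (nneseries_lim_ge j.+1 _) => //.
  by rewrite big_nat_recr//= leeDr// sume_ge0.
rewrite ge0_integralD//; last 2 first.
- by move=> w _; rewrite mule_ge0 ?lee_fin ?mulr_ge0// nneseries_ge0.
- exact: measurable_funeM.
rewrite integral_cst// [X in (_ * X + _)%E](_ : _ = 1%E) ?mule1; last first.
  exact: probability_setT.
rewrite ge0_integralZl_EFin ?mulr_ge0//; last by move=> w _; exact: nneseries_ge0.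
rewrite integral_nneseries//.
under eq_eseriesr do rewrite integral_term//.
by rewrite lte_add_pinfty ?ltry// lte_mul_pinfty ?lee_fin ?mulr_ge0.
Qed.

(** Pointwise, a partial sum of the weighted indicators is at most the geometric sum up to the last
    event that occurs; the normalization [a] turns it into the lower bound [c * b ^ N] for [X]. *)
Lemma integral_lower X E (b c : R) : 1 < b -> 0 < c ->
  (forall w, 0 <= X w)%E -> (forall j, measurable (E j)) ->
  (forall j w, E j w -> (c * b ^+ j)%:E <= X w)%E ->
  (\int[P]_w X w < +oo)%E -> (\sum_(j <oo) (b ^+ j)%:E * P (E j) < +oo)%E.
Proof.
move=> b1 c0 X0 mE XE intX; have b0 : 0 < b by apply: lt_trans b1.
have bj j : 0 <= b ^+ j by exact/exprn_ge0/ltW.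
pose a := c / (b / (b - 1)).
have a0 : 0 < a by rewrite !divr_gt0// subr_gt0.
pose f j w := (a * b ^+ j * \1_(E j) w)%:E : \bar R.
have ab j : 0 <= a * b ^+ j by rewrite mulr_ge0// ltW.
have f0 j w : (0 <= f j w)%E by rewrite lee_fin mulr_ge0.
have mf j : measurable_fun setT (f j) by exact: measurable_term.
have : (\int[P]_w (\sum_(j <oo) f j w) < +oo)%E.
  apply: le_lt_trans intX; apply: ge0_le_lower_integral => w.
    exact: nneseries_ge0.
  apply: nneseries_le_partial => //; elim=> [|N IH]; first by rewrite big_geq.
  have [EN|nEN] := pselect (E N w); last first.
    by rewrite big_nat_recr//= /f indicE memNset// mulr0 adde0.
  apply: le_trans (XE _ _ EN).
  apply: (@le_trans _ _ (\sum_(0 <= j < N.+1) (a * b ^+ j)%:E)%E).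
    apply: lee_sum => j _; rewrite lee_fin -[leRHS]mulr1 ler_wpM2l//.
  rewrite sumEFin lee_fin -mulr_sumr.
  apply: le_trans (ler_wpM2l (ltW a0) (geometric_sum_le N b1)) _.
  by rewrite mulrA divfK// gt_eqF// divr_gt0// subr_gt0.
rewrite integral_nneseries//.
under eq_eseriesr do rewrite integral_term// EFinM -muleA.
rewrite nneseriesZl; last first.
  by move=> j _; rewrite mule_ge0// ?lee_fin.
set S := (\sum_(_ <oo) _)%E; have [->|Sn _] := eqVneq S +oo%E.
  by rewrite gt0_muley ?lte_fin// ltxx.
by rewrite ltey.
Qed.

End moment_bounds.

(** * The recursion on crossing probabilities *)

Lemma measure_bigsetU_le d (T : measurableType d) (R : realType)
    (m : {measure set T -> \bar R}) (I : Type) (s : seq I) (F : I -> set T) :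
  (forall i, measurable (F i)) ->
  (m (\big[setU/set0]_(i <- s) F i) <= \sum_(i <- s) m (F i))%E.
Proof.
move=> mF; elim: s => [|i s IH]; first by rewrite !big_nil measure0.
rewrite !big_cons; apply: le_trans (measureU2 _ _ _) _ => //.
  exact: bigsetU_measurable.
exact: leeD.
Qed.

Section recursion.
Context {R : realType} (n : nat) {dO : measure_display}
  {Omega : measurableType dO} (P : probability Omega R).
Hypothesis n_ge2 : (2 <= n)%N.
Variables (xi : Omega -> set ('rV[R]_n * R)) (nu : probability R R) (lambda : R).
Hypothesis lambda_ge0 : 0 <= lambda.
Hypothesis H : poisson_point_process P xi (boolean_intensity nu lambda).
Local Notation pt := ('rV[R]_n * R)%type.
Local Notation T := (scale n).
Local Notation mu := (boolean_intensity (d := n) nu lambda).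

Definition layer k : set R := `[T%:R ^+ k, T%:R ^+ k.+1[%classic.

(** Radii here are below [T ^ k.+1], so the exponent [k.+2] turns emptiness of the shell into the
    scale-free bound of [no_big_balls]. *)
Definition shell k : set pt :=
  [set z | `|z| < ctr_ratio n * T%:R ^+ k.+2] `*` layer k.

Definition shell_const : R := (2 * (ctr_ratio n * T%:R ^+ 2)) ^+ n.

Let Tgt0 k : 0 < T%:R ^+ k :> R.
Proof. exact: scaleX_gt0. Qed.

Let ctr_gt0 : 0 < ctr_ratio n :> R.
Proof. by rewrite /ctr_ratio; have := ler0n R n; lra. Qed.

Lemma measurable_layer k : measurable (layer k).
Proof. exact: measurable_itv. Qed.

Lemma measurable_shell k : measurable (shell k).
Proof. by apply: measurableX; [exact: measurable_open_box|exact: measurable_layer]. Qed.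

Lemma mu_shell k :
  (mu (shell k) =
   (lambda * shell_const)%:E * (((T%:R ^+ k) ^+ n)%:E * nu (layer k)))%E.
Proof.
rewrite boolean_intensity_rect; last exact: measurable_layer.
  rewrite lebesgue_open_box; last by rewrite mulr_gt0.
  rewrite !muleA -!EFinM; congr (_%:E * _)%E.
  rewrite /shell_const -[RHS]mulrA -exprMn; congr (_ * _ ^+ _).
  by rewrite !exprS; ring.
exact: measurable_open_box.
Qed.

Lemma mu_shell_ge0 k : (0 <= mu (shell k))%E.
Proof. exact: boolean_intensity_ge0. Qed.

(** A large ball can reach the origin from far away, so all layers from [j] on are watched, each in
    a region proportional to its radii. *)
Definition big_balls j : set Omega :=
  \bigcup_k (if (j <= k)%N then occupies xi (shell k) else set0).

Lemma measurable_big_balls j : measurable (big_balls j).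
Proof.
apply: bigcup_measurable => k _; case: ifP => // _.
exact: (measurable_occupies H (measurable_shell k)).
Qed.

Lemma prob_big_balls j :
  (P (big_balls j) <= \sum_(k <oo) if (j <= k)%N then mu (shell k) else 0)%E.
Proof.
have mE k : measurable (if (j <= k)%N then occupies xi (shell k) else set0).
  by case: ifP => // _; exact: (measurable_occupies H (measurable_shell k)).
apply: (le_trans (generalized_Boole_inequality _ mE _)).
  exact: measurable_big_balls.
apply: lee_nneseries => k _ //; case: ifP => _; last by rewrite measure0.
apply: (prob_occupies_le H); last exact: measurable_shell.
by move=> A; exact: boolean_intensity_ge0.
Qed.

Lemma layer_ex j (r : R) : T%:R ^+ j <= r -> exists2 k, (j <= k)%N & layer k r.
Proof.
move=> jr; have T1 := @scale_gt1 R n n_ge2.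
have ex : exists k, r < T%:R ^+ k.+1.
  exists (Num.trunc r).+1; apply: lt_trans (truncnS_gt r) _.
  have : forall k, k.+1%:R <= T%:R ^+ k.+1 :> R.
    elim=> [|k IH]; first by rewrite expr1 ltW.
    rewrite exprS -[k.+2]addn1 natrD; have T2 : 2 <= T%:R :> R.
      by rewrite ler_nat /scale (leq_trans _ (leq_addl _ _)).
    have : 1 <= k.+1%:R :> R by rewrite ler1n.
    by nra.
  move=> /(_ (Num.trunc r)) /le_lt_trans; apply.
  by rewrite [ltRHS]exprS ltr_pMl.
case: (ex_minnP ex) => k rk kmin; exists k.
  by rewrite -ltnS -(ltr_eXn2l T1); apply: le_lt_trans rk.
rewrite /layer/= in_itv/= rk andbT.
case: k rk kmin => [|k] rk kmin; last first.
  by rewrite leNgt; apply/negP => /kmin; rewrite ltnn.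
have : (j < 1)%N by rewrite -(ltr_eXn2l T1); apply: le_lt_trans rk.
by rewrite ltnS leqn0 => /eqP j0; rewrite j0 in jr.
Qed.

Lemma no_big_balls j w q : ~ big_balls j w -> xi w q -> T%:R ^+ j <= q.2 ->
  ctr_ratio n * T%:R * q.2 <= `|q.1|.
Proof.
move=> nbig wq /layer_ex[k jk kq]; rewrite leNgt; apply/negP => qlt.
apply: nbig; exists k => //; rewrite jk; exists q; split=> //; split=> //=.
apply: lt_le_trans qlt _; rewrite -mulrA ler_pM2l// [leRHS]exprS ler_pM2l//.
  by move: kq; rewrite /layer/= in_itv/= => /andP[_ /ltW].
by have := @scale_gt1 R n n_ge2; lra.
Qed.

Definition scale_crossing j : set Omega :=
  crossing xi (window (T%:R ^+ j)) (inner (T%:R ^+ j)) (outer (T%:R ^+ j)) 0.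

Lemma shift0 (S : set pt) : shift 0 S = S.
Proof. by apply/seteqP; split=> -[c r]; rewrite /shift/= addr0. Qed.

Lemma measurable_scale_crossing j : measurable (scale_crossing j).
Proof. exact: (measurable_crossing H _ _ (@open_window R n _) _). Qed.

Definition mesh_const : R := #|{: mesh_index n * mesh_index n}|%:R.

Definition crossing_prob j : R := fine (P (scale_crossing j)).

Lemma crossing_prob_ge0 j : 0 <= crossing_prob j.
Proof. exact: fine_ge0. Qed.

Lemma crossing_probE j : P (scale_crossing j) = (crossing_prob j)%:E.
Proof. by rewrite fineK// fin_num_measure//; exact: measurable_scale_crossing. Qed.

(* Without big balls, a crossing at scale [T ^ j.+1] entails crossings at scale
   [T ^ j] from two mesh points whose windows are disjoint. *)
Lemma crossing_recursion j :
  ((crossing_prob j.+1)%:E <=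
   (mesh_const * crossing_prob j ^+ 2)%:E + P (big_balls j))%E.
Proof.
pose a : R := T%:R ^+ j.
pose cr (g : mesh_index n) :=
  crossing xi (window a) (inner a) (outer a) (mesh_point a g).
have mcr g : measurable (cr g).
  exact: (measurable_crossing H _ _ (@open_window R n _) _).
(* Pairs that are not far apart contribute nothing, which lets the union bound run over all pairs,
   [mesh_const] in number. *)
pose D (gh : mesh_index n * mesh_index n) : set Omega :=
  if far_mesh a gh then cr gh.1 `&` cr gh.2 else set0.
have mD gh : measurable (D gh).
  by rewrite /D; case: ifP => // _; exact: measurableI.
have PD gh : (P (D gh) <= (crossing_prob j ^+ 2)%:E)%E.
  rewrite /D; case: ifP => [gh_far|_]; last by rewrite measure0 lee_fin sqr_ge0.
  rewrite (prob_crossingI lambda_ge0 H _ _ (@open_window R n _)); last first.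
    by move=> p q; exact: far_mesh_window.
  rewrite !(prob_crossing_shift lambda_ge0 H _ _ (@open_window R n _) _ 0).
  by rewrite -[P _]/(P (scale_crossing j)) crossing_probE -EFinM expr2.
pose UD := \big[setU/set0]_(gh : mesh_index n * mesh_index n) D gh.
have mUD : measurable UD by exact: bigsetU_measurable.
have sub : scale_crossing j.+1 `<=` UD `|` big_balls j.
  move=> w; rewrite /scale_crossing /crossing/= shift0 exprS -/a => cw.
  have [bw|nbw] := pselect (big_balls j w); first by right.
  (* A ball of radius at least [a] centered in this window would contradict [nbw], so the windowed
     configuration has only radii below [a]. *)
  left; have := @crosses_double R n n_ge2 (xi w `&` window (T%:R * a)) a (Tgt0 j).
  case=> //.
    move=> q [wq]; rewrite /window/= => qwin; rewrite ltNge; apply/negP => aq.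
    have := no_big_balls nbw wq aq; rewrite leNgt => /negP; apply.
    apply: lt_le_trans qwin _; rewrite -mulrA ler_pM2l// ler_pM2l//.
    by have := @scale_gt1 R n n_ge2; lra.
  move=> gh gh_far [c1 c2]; rewrite /UD -bigcup_seq.
  exists gh; first by rewrite /= mem_index_enum.
  rewrite /D gh_far; split.
    apply: crosses_sub c1 => //; apply: setSI => p.
    by rewrite /shift/= => -[].
  apply: crosses_sub c2 => //; apply: setSI => p.
  by rewrite /shift/= => -[].
rewrite -crossing_probE; apply: (@le_trans _ _ (P (UD `|` big_balls j))).
  apply: le_measure => //; rewrite inE; first exact: measurable_scale_crossing.
  by apply: measurableU => //; exact: measurable_big_balls.
apply: le_trans (measureU2 _ mUD (measurable_big_balls j)) _.
rewrite leeD2r//; apply: le_trans (measure_bigsetU_le P _ mD) _.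
apply: (@le_trans _ _ (\sum_(gh : mesh_index n * mesh_index n)
  (crossing_prob j ^+ 2)%:E)%E); first by apply: lee_sum => gh _; exact: PD.
by rewrite sumEFin sumr_const /mesh_const mulr_natl.
Qed.

Definition escape j : set Omega := big_balls j `|` scale_crossing j.

Lemma measurable_escape j : measurable (escape j).
Proof.
by apply: measurableU; [exact: measurable_big_balls|exact: measurable_scale_crossing].
Qed.

Lemma prob_escape_le j :
  (P (escape j) <= P (big_balls j) + (crossing_prob j)%:E)%E.
Proof.
rewrite -crossing_probE; apply: measureU2; first exact: measurable_big_balls.
exact: measurable_scale_crossing.
Qed.

Lemma mesh_const_gt0 : 0 < mesh_const.
Proof.
by rewrite ltr0n card_prod card_ffun !card_ord addn1 muln_gt0 expn_gt0.
Qed.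

Lemma big_ballsE j : P (big_balls j) = (fine (P (big_balls j)))%:E.
Proof. by rewrite fineK// fin_num_measure//; exact: measurable_big_balls. Qed.

Lemma sum_big_balls (b : R) : 1 < b ->
  (\sum_(k <oo) (b ^+ k)%:E * mu (shell k) < +oo)%E ->
  (\sum_(j <oo) (b ^+ j)%:E * P (big_balls j) < +oo)%E.
Proof.
move=> b1 sb; have b0 : 0 < b by apply: lt_trans b1.
apply: (@le_lt_trans _ _ ((b / (b - 1))%:E *
  \sum_(k <oo) (b ^+ k)%:E * mu (shell k))%E); last first.
  rewrite lte_mul_pinfty// lee_fin divr_ge0//; first exact: ltW.
  by rewrite subr_ge0 ltW.
apply: le_trans (weighted_tails b1 mu_shell_ge0).
apply: lee_nneseries => [j _ _|j _].
  by rewrite mule_ge0// lee_fin exprn_ge0// ltW.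
rewrite lee_pmul2l//; first exact: prob_big_balls.
by rewrite lte_fin exprn_gt0.
Qed.

(** [quadratic_recursion] is run on the sequence shifted by [j0], where smallness holds; the terms
    before [j0] are finitely many. *)
Lemma sum_escape (b : R) j0 : 1 < b ->
  (\sum_(k <oo) (b ^+ k)%:E * mu (shell k) < +oo)%E ->
  (forall j, (j0 <= j)%N -> mesh_const * crossing_prob j <= (2 * b)^-1) ->
  (\sum_(j <oo) (b ^+ j)%:E * P (escape j) < +oo)%E.
Proof.
move=> b1 sb small; have b0 : 0 < b by apply: lt_trans b1.
have bj j : 0 <= b ^+ j by rewrite exprn_ge0// ltW.
have bje j : (0 <= (b ^+ j)%:E * P (big_balls j))%E.
  by rewrite mule_ge0// lee_fin.
have sbig := sum_big_balls b1 sb.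
have sbig0 : (0 <= \sum_(j <oo) (b ^+ j)%:E * P (big_balls j))%E.
  exact: nneseries_ge0.
pose D := fine (\sum_(j <oo) (b ^+ j)%:E * P (big_balls j))%E.
have DE : (D%:E = \sum_(j <oo) (b ^+ j)%:E * P (big_balls j))%E.
  by rewrite fineK// ge0_fin_numE.
pose delta j := fine (P (big_balls j)).
have delta0 j : 0 <= delta j by exact: fine_ge0.
pose f j := b ^+ j * crossing_prob j.
have f0 j : 0 <= f j by rewrite mulr_ge0// crossing_prob_ge0.
have partial N : \sum_(0 <= j < N) b ^+ j * crossing_prob (j0 + j) <=
    2 * (crossing_prob (j0 + 0) + b * D).
  apply: (@quadratic_recursion _ b mesh_const (fun j => crossing_prob (j0 + j))
    (fun j => delta (j0 + j)%N) D) => //.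
  - by move=> j; exact: crossing_prob_ge0.
  - by move=> j; apply: small; exact: leq_addr.
  - move=> j; have := crossing_recursion (j0 + j).
    by rewrite big_ballsE -EFinD lee_fin addnS.
  - move=> M; rewrite -lee_fin DE.
    apply: le_trans (nneseries_lim_ge (j0 + M) _); last first.
      by [].
    rewrite [leRHS](eq_bigr (fun i => (b ^+ i * delta i)%:E)); last first.
      by move=> i _; rewrite big_ballsE -EFinM.
    rewrite sumEFin lee_fin [leRHS](big_cat_nat (n := j0)) ?leq_addr//=.
    apply: (@le_trans _ _ (\sum_(j0 <= i < j0 + M) b ^+ i * delta i)); last first.
      by rewrite lerDr sumr_ge0// => j _; rewrite mulr_ge0.
    rewrite -{2}[j0]add0n big_addn addKn; apply: ler_sum => j _.
    rewrite (addnC j j0) ler_wpM2r// exprD ler_peMl// exprn_ege1//.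
    exact: ltW.
pose M := \sum_(0 <= j < j0) f j +
  b ^+ j0 * (2 * (crossing_prob (j0 + 0) + b * D)).
have fM : (\sum_(j <oo) (f j)%:E <= M%:E)%E.
  apply: nneseries_le_partial => [k|N]; first by rewrite lee_fin.
  rewrite sumEFin lee_fin; apply: (@le_trans _ _ (\sum_(0 <= j < j0 + N) f j)).
    rewrite [leRHS](big_cat_nat (n := N)) ?leq_addl//= lerDl sumr_ge0// => j _.
  rewrite (big_cat_nat (n := j0)) ?leq_addr//= lerD2l.
  rewrite -{1}[j0]add0n big_addn addKn.
  apply: le_trans (ler_wpM2l (bj j0) (partial N)).
  rewrite mulr_sumr; apply: ler_sum => j _.
  by rewrite /f (addnC j j0) exprD mulrA.
apply: (@le_lt_trans _ _ (\sum_(j <oo) ((b ^+ j)%:E * P (big_balls j) + (f j)%:E))%E).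
  apply: lee_nneseries => [j _ _|j _]; first by rewrite mule_ge0// lee_fin.
  rewrite /f EFinM -ge0_muleDr// ?lee_fin ?crossing_prob_ge0//.
  by rewrite lee_wpmul2l// ?lee_fin//; exact: prob_escape_le.
rewrite nneseriesD => [|j _ _|j _ _]; [|by []|by rewrite lee_fin].
by rewrite lte_add_pinfty//; apply: le_lt_trans fM _; rewrite ltry.
Qed.

(** A crossing needs at least one center in its window. The bound is linear in [lambda], and so
    starts the induction of [crossing_prob_small] at small intensity. *)
Lemma crossing_prob0_le : crossing_prob 0 <= lambda * (2 * ctr_ratio n) ^+ n.
Proof.
pose B : set pt := [set z : 'rV[R]_n | `|z| < ctr_ratio n] `*` [set: R].
have mB : measurable B by apply: measurableX => //; exact: measurable_open_box.
rewrite -lee_fin -crossing_probE; apply: (@le_trans _ _ (P (occupies xi B))).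
  apply: le_measure; rewrite ?inE; first exact: measurable_scale_crossing.
    exact: (measurable_occupies H mB).
  move=> w [p /chained_in[]]; rewrite shift0 /window/= expr0 mulr1 => wp pw _.
  by exists p.
apply: (le_trans (prob_occupies_le H _ mB)).
  by move=> A; exact: boolean_intensity_ge0.
rewrite boolean_intensity_rect//; last exact: measurable_open_box.
by rewrite lebesgue_open_box// probability_setT mule1 -EFinM.
Qed.

(** The bound reproduces itself: after multiplication by [mesh_const], the quadratic term is at most
    [(2 * b)^-1 / 2] and the big balls at most [(4 * b)^-1], which add up to [(2 * b)^-1]. *)
Lemma crossing_prob_small (b V : R) : 1 <= b ->
  (\sum_(k <oo) mu (shell k) <= V%:E)%E ->
  mesh_const * crossing_prob 0 <= (2 * b)^-1 ->
  mesh_const * V <= (4 * b)^-1 ->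
  forall j, mesh_const * crossing_prob j <= (2 * b)^-1.
Proof.
move=> b1 sV x0 CV; have b0 : 0 < b by apply: lt_le_trans b1.
have C0 := mesh_const_gt0.
elim=> // j IH; have := crossing_recursion j.
have : (P (big_balls j) <= V%:E)%E.
  apply: le_trans (prob_big_balls j) _; apply: le_trans sV.
  apply: lee_nneseries => [k _ _|k _].
    by case: ifP => // _; exact: mu_shell_ge0.
  by case: ifP => // _; exact: mu_shell_ge0.
rewrite big_ballsE lee_fin -EFinD lee_fin => PV rec.
set x := crossing_prob j in IH rec *; set y := crossing_prob j.+1 in rec *.
have xge0 : 0 <= x := crossing_prob_ge0 j.
have b2 : (2 * b)^-1 <= 2^-1 by rewrite lef_pV2 ?posrE ?mulr_gt0// ler_peMr.
have b4 : (2 * b)^-1 = 2 * (4 * b)^-1 by field; rewrite gt_eqF.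
have y1 : mesh_const * y <= mesh_const * (mesh_const * x ^+ 2 + V).
  by rewrite ler_pM2l//; apply: le_trans rec _; rewrite lerD2l.
have sq : (mesh_const * x) ^+ 2 <= (2 * b)^-1 * 2^-1.
  have C1 : 0 <= mesh_const * x by rewrite mulr_ge0// ltW.
  by rewrite expr2 ler_pM//; apply: le_trans IH _.
move: y1; rewrite mulrDr mulrA -expr2 -exprMn => y1.
by rewrite b4 in sq *; lra.
Qed.

End recursion.

(** * Poisson tails *)

Section exponential_series.
Context {R : realType}.
Implicit Types (x m : R).

Lemma exp_partial_le x N : 0 <= x -> \sum_(0 <= k < N) x ^+ k / k`!%:R <= expR x.
Proof.
move=> x0; have := @nondecreasing_cvgn_le R (series (exp_coeff x)).
rewrite /expR; apply; last exact: is_cvg_series_exp_coeff.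
move=> a c ac; rewrite /series/= [leRHS](big_cat_nat (n := a))//= lerDl sumr_ge0// => k _.
by rewrite /exp_coeff/= divr_ge0// exprn_ge0.
Qed.

Lemma exp_le_partial x M : (forall N, \sum_(0 <= k < N) x ^+ k / k`!%:R <= M) ->
  expR x <= M.
Proof.
move=> h; apply: limr_le; first exact: is_cvg_series_exp_coeff.
by apply: nearW => N; exact: h.
Qed.

(** Exponential Markov inequality with base 2: each term of index [k >= N] is multiplied by
    [2 ^ (k - N)], at least 1. In [exp_head_le] the factor is [2 ^ (N - k)]. *)
Lemma exp_tail_le m N : 0 <= m ->
  expR m <= \sum_(0 <= k < N) m ^+ k / k`!%:R + 2 ^- N * expR (2 * m).
Proof.
move=> m0; apply: exp_le_partial => M.
have t0 k : 0 <= m ^+ k / k`!%:R by rewrite divr_ge0// exprn_ge0.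
apply: (@le_trans _ _ (\sum_(0 <= k < N + M) m ^+ k / k`!%:R)).
  by rewrite [leRHS](big_cat_nat (n := M)) ?leq_addl//= lerDl sumr_ge0.
rewrite (big_cat_nat (n := N)) ?leq_addr//= lerD2l.
apply: (@le_trans _ _ (2 ^- N * \sum_(0 <= k < N + M) (2 * m) ^+ k / k`!%:R)).
  rewrite [X in _ * X](big_cat_nat (n := N)) ?leq_addr//= mulrDr.
  rewrite -[leLHS]add0r lerD//.
    rewrite mulr_ge0// ?invr_ge0 ?exprn_ge0// sumr_ge0// => k _.
    by rewrite divr_ge0// exprn_ge0// mulr_ge0.
  rewrite mulr_sumr big_nat_cond [leRHS]big_nat_cond; apply: ler_sum => k.
  move=> /andP[/andP[Nk _] _]; rewrite exprMn (_ : 2 ^- N * _ =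
    2 ^- N * 2 ^+ k * (m ^+ k / k`!%:R)); last by rewrite !mulrA.
  rewrite ler_peMl//.
  by rewrite mulrC ler_pdivlMr ?exprn_gt0// mul1r ler_weXn2l// ler1n.
rewrite ler_wpM2l ?invr_ge0 ?exprn_ge0//; apply: exp_partial_le.
exact: mulr_ge0.
Qed.

Lemma exp_head_le m N : 0 <= m ->
  \sum_(0 <= k < N) m ^+ k / k`!%:R <= 2 ^+ N * expR (m / 2).
Proof.
move=> m0; apply: (@le_trans _ _ (2 ^+ N *
    \sum_(0 <= k < N) (m / 2) ^+ k / k`!%:R)); last first.
  by rewrite ler_wpM2l ?exprn_ge0//; apply: exp_partial_le; exact: divr_ge0.
rewrite mulr_sumr big_nat_cond [leRHS]big_nat_cond; apply: ler_sum => k.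
move=> /andP[/andP[_ kN] _]; rewrite expr_div_n mulrA ler_wpM2r// mulrCA ler_peMr//.
  by rewrite exprn_ge0.
by rewrite ler_pdivlMr ?exprn_gt0// mul1r ler_weXn2l ?ler1n// ltnW.
Qed.

Lemma expR_half_le2 : expR (2^-1) <= 2 :> R.
Proof.
have := expR_ge1Dx (- 2^-1 : R); have := expRxMexpNx_1 (2^-1 : R).
by have := expR_gt0 (2^-1 : R); nra.
Qed.

Lemma expr_unbounded (A t : R) : 1 < t -> exists p, A <= t ^+ p.
Proof.
move=> t1; pose p := (Num.trunc (A / (t - 1))).+1; exists p.
have t0 : 0 < t by apply: lt_trans t1.
have bern : forall k, 1 + k%:R * (t - 1) <= t ^+ k.
  elim=> [|k IH]; first by rewrite mul0r addr0 expr0.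
  rewrite exprS -[k.+1]addn1 natrD.
  have : 0 <= k%:R * (t - 1) ^+ 2 by rewrite mulr_ge0// sqr_ge0.
  by move: IH t0; rewrite expr2; nra.
apply: (le_trans _ (bern p)); rewrite ler_wpDl//.
by rewrite -ler_pdivrMr ?subr_gt0//; apply/ltW/truncnS_gt.
Qed.

(** With [p] such that [t ^ p >= 2 * b], the inequality [expR (- x) <= p! / x ^ p] bounds the term
    of index [j] by a constant times [2 ^- j]. *)
Lemma sum_expr_expR (b t c : R) : 1 < b -> 1 < t -> 0 < c ->
  (\sum_(j <oo) (b ^+ j)%:E * (expR (- (c * t ^+ j)))%:E < +oo)%E.
Proof.
move=> b1 t1 c0; have b0 : 0 < b by apply: lt_trans b1.
have t0 : 0 < t by apply: lt_trans t1.
have [p tp] := expr_unbounded (2 * b) t1.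
pose A := p`!%:R / c ^+ p.
have A0 : 0 <= A by rewrite divr_ge0// exprn_ge0// ltW.
apply: (@le_lt_trans _ _ (2 * A)%:E); last by rewrite ltry.
apply: nneseries_le_partial => [k|N].
  by rewrite mule_ge0// lee_fin ?expR_ge0// exprn_ge0// ltW.
apply: (@le_trans _ _ (\sum_(0 <= j < N) (A * 2^-1 ^+ j)%:E)%E).
  apply: lee_sum => j _; rewrite -EFinM lee_fin.
  set x := c * t ^+ j; have x0 : 0 < x by rewrite mulr_gt0// exprn_gt0.
  have : x ^+ p / p`!%:R <= expR x.
    apply: (le_trans _ (exp_partial_le p.+1 (ltW x0))).
    rewrite big_nat_recr//= lerDr sumr_ge0// => k _.
    by rewrite divr_ge0// exprn_ge0// ltW.
  have f0 : 0 < p`!%:R :> R by rewrite ltr0n fact_gt0.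
  rewrite -lef_pV2 ?posrE ?expR_gt0 ?divr_gt0 ?exprn_gt0// -expRN => ex.
  apply: le_trans (ler_wpM2l (exprn_ge0 j (ltW b0)) ex) _.
  rewrite invf_div /x exprMn -exprM mulnC exprM.
  have tj : (2 * b) ^+ j <= (t ^+ p) ^+ j.
    by rewrite lerXn2r// ?nnegrE ?mulr_ge0 ?exprn_ge0// ltW.
  have u0 : 0 < (t ^+ p) ^+ j by rewrite exprn_gt0// exprn_gt0.
  have cp0 : 0 < c ^+ p by rewrite exprn_gt0.
  have -> : b ^+ j * (p`!%:R / (c ^+ p * (t ^+ p) ^+ j)) =
      A * (b ^+ j / (t ^+ p) ^+ j).
    by rewrite /A; field; rewrite !gt_eqF.
  rewrite ler_wpM2l// ler_pdivrMr// exprVn mulrC ler_pdivlMr ?exprn_gt0//.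
  by rewrite mulrC -exprMn.
rewrite sumEFin lee_fin -mulr_sumr mulrC ler_wpM2r//.
have := subrX1 (2^-1 : R) N; rewrite -(big_mkord xpredT (fun i => 2^-1 ^+ i)).
have : 0 <= (2^-1 : R) ^+ N by rewrite exprn_ge0.
lra.
Qed.

End exponential_series.

Lemma countingP (R : realType) (T : choiceType) (X : set T) :
  (counting X = +oo :> \bar R)%E \/ exists k : nat, (counting X = k%:R%:E :> \bar R)%E.
Proof.
by rewrite /counting; case: ifPn => _; [right; eexists|left].
Qed.

Section poisson_tails.
Context {R : realType} (n : nat) {dO : measure_display}
  {Omega : measurableType dO} (P : probability Omega R).
Variables (xi : Omega -> set ('rV[R]_n * R)) (mu : set ('rV[R]_n * R) -> \bar R).
Hypothesis H : poisson_point_process P xi mu.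
Variable A : set ('rV[R]_n * R).
Hypothesis mA : measurable A.
Hypothesis A_fin : (mu A < +oo)%E.
Let m := fine (mu A).
Hypothesis m_gt0 : 0 < m.

Definition many N : set Omega := [set w | N%:R%:E <= npoints xi A w]%E.

Lemma measurable_many N : measurable (many N).
Proof.
have -> : many N = npoints xi A @^-1` `[N%:R%:E, +oo[.
  apply/seteqP; split=> w; rewrite /many/= in_itv/= ?andbT//.
rewrite -[X in measurable X]setTI; apply: (ppp_measurable H mA) => //.
exact: emeasurable_itv.
Qed.

Lemma prob_not_many N :
  P (~` many N) = (\sum_(0 <= k < N) m ^+ k / k`!%:R * expR (- m))%:E.
Proof.
elim: N => [|N IH].
  rewrite big_geq// (_ : ~` _ = set0) ?measure0//; apply/seteqP; split=> // w.
  by rewrite /many/=; apply; exact: counting_ge0.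
pose E := [set w | npoints xi A w = N%:R%:E].
have -> : ~` many N.+1 = ~` many N `|` E.
  apply/seteqP; split=> w; rewrite /many /E/= /npoints.
    have [->|[k ->]] := countingP R (xi w `&` A); first by rewrite leey.
    rewrite !lee_fin !ler_nat ltnNge => /negP; rewrite negbK leq_eqVlt.
    by case/orP => [/eqP ->|kN]; [right|left; apply/negP; rewrite -ltnNge].
  move=> [|->]; last by rewrite lee_fin ler_nat ltnn.
  by apply: contra_not; apply: le_trans; rewrite lee_fin ler_nat.
have mE : measurable E.
  have -> : E = npoints xi A @^-1` [set N%:R%:E] by [].
  by rewrite -[X in measurable X]setTI; exact: (ppp_measurable H mA).
rewrite measureU//; last 2 first.
- by apply: measurableC; exact: measurable_many.
- apply/seteqP; split=> // w [/= + Ew]; rewrite /many/= Ew.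
  by apply.
rewrite big_nat_recr//= EFinD; congr (_ + _)%E; first exact: IH.
apply: (etrans (ppp_poisson H mA A_fin N)); rewrite /poisson_prob -/m m_gt0.
by rewrite esum_set1 ?lee_fin ?poisson_pmf_ge0// /poisson_pmf m_gt0.
Qed.

(** By [exp_tail_le] the probability is at most [expR (- m)] times [2 ^- N * expR (2 * m)], and the
    latter is at most 1 because [expR (2 * m) <= expR (N / 2) <= 2 ^ N]. *)
Lemma prob_many_le N : 4 * m <= N%:R -> (P (many N) <= (expR (- m))%:E)%E.
Proof.
move=> mN; rewrite -[many N]setCK probability_setC; last first.
  by apply: measurableC; exact: measurable_many.
rewrite prob_not_many -EFinB lee_fin -mulr_suml.
have := exp_tail_le N (ltW m_gt0); set S := \sum_(_ <= _ < _) _ => tail.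
have e0 : 0 < expR (- m) by exact: expR_gt0.
have ee : expR m * expR (- m) = 1 by rewrite -expRD subrr expR0.
have N2 : expR (2 * m) <= 2 ^+ N.
  apply: (@le_trans _ _ (expR (N%:R * 2^-1))).
    by rewrite ler_expR; move: mN; lra.
  by rewrite expRM_natl lerXn2r ?nnegrE ?expR_ge0// expR_half_le2.
have r1 : 2 ^- N * expR (2 * m) <= 1.
  by rewrite mulrC ler_pdivrMr ?exprn_gt0// mul1r.
have : (expR m - S) * expR (- m) <= 1 * expR (- m).
  rewrite ler_wpM2r//.
  by rewrite lerBlDl; apply: le_trans tail _; rewrite lerD2l.
by rewrite mulrBl ee mul1r.
Qed.

(** By [exp_head_le] and [2 <= expR 1], the complement has probability at most [expR (N - m / 2)],
    hence at most [expR (- m / 4)], and [m >= 4] makes this at most one half. *)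
Lemma prob_many_ge N : 4 <= m -> 4 * N%:R <= m -> (2^-1%:E <= P (many N))%E.
Proof.
move=> m4 mN; rewrite -[many N]setCK probability_setC; last first.
  by apply: measurableC; exact: measurable_many.
rewrite prob_not_many -EFinB lee_fin -mulr_suml lerBrDr -lerBrDl.
have e2 : 2 <= expR 1 :> R by have := expR_ge1Dx (1 : R); lra.
apply: (@le_trans _ _ (2 ^+ N * expR (m / 2) * expR (- m))).
  by rewrite ler_wpM2r ?expR_ge0//; apply: exp_head_le; exact: ltW.
apply: (@le_trans _ _ (expR N%:R * expR (m / 2) * expR (- m))).
  rewrite !ler_wpM2r ?expR_ge0// -[N%:R]mulr1 expRM_natl.
  by rewrite lerXn2r ?nnegrE ?expR_ge0.
rewrite -!expRD; apply: (@le_trans _ _ (expR (-1))).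
  by rewrite ler_expR; move: m4 mN; lra.
rewrite expRN (_ : 1 - 2^-1 = 2^-1); last by field.
by rewrite lef_pV2 ?posrE ?expR_gt0.
Qed.

End poisson_tails.

(** * Upper bounds on the cluster *)

Section powers.
Context {R : realType}.

Lemma poweR_le (x y : \bar R) (r : R) : 0 <= r -> (0 <= x)%E -> (x <= y)%E ->
  (x `^ r <= y `^ r)%E.
Proof.
move=> r0 x0 xy; apply: gt0_ler_poweR => //; rewrite in_itv/= leey andbT//.
exact: le_trans xy.
Qed.

Lemma powR_expr (x s : R) k : 0 <= x -> (x ^+ k) `^ s = (x `^ s) ^+ k.
Proof.
move=> x0; rewrite -(powR_mulrn k x0) -(powR_mulrn k (powR_ge0 _ _)).
by rewrite -!powRrM mulrC.
Qed.

Lemma powR_root (x s : R) n : (0 < n)%N -> 0 <= x ->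
  (x ^+ n) `^ (s / n%:R) = x `^ s.
Proof.
move=> n0 x0; rewrite -powR_mulrn// -powRrM mulrC divfK//.
by rewrite pnatr_eq0 -lt0n.
Qed.

Lemma powR_scale (a t s : R) k : 0 <= a -> 0 <= t ->
  (a * t ^+ k) `^ s = a `^ s * (t `^ s) ^+ k.
Proof. by move=> a0 t0; rewrite powRM ?exprn_ge0// powR_expr. Qed.

End powers.

Lemma open_measurable_rV (R : realType) n (O : set 'rV[R]_n) :
  open O -> measurable O.
Proof.
move=> oO; pose I m := {ffun 'I_n -> 'I_(slot_count m)}.
have -> : O = \bigcup_m \bigcup_(g in [set g : I m | @box_cell R n m g `<=` O])
    @box_cell R n m g.
  apply/seteqP; split=> [x Ox|x [m _ [g gO]]]; last exact: gO.
  have oOT : open ((fst : 'rV[R]_n * R -> _) @^-1` O).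
    by apply: open_comp oO => p _; exact: cvg_fst.
  (* The dummy radius 0 allows the cells of the product space to be reused. *)
  have [m0 /(_ m0 (leqnn _))[[g k] [xg x0] gO]] := @cell_near R n (x, 0) _ oOT Ox.
  exists m0 => //; exists g => // y yg.
  exact: (gO (y, 0) (conj yg x0)).
apply: bigcup_measurable => m _.
apply: fin_bigcup_measurable => [|g _]; first exact: finite_finset.
apply: (@measurable_box R n (fun i => slot m (g i))) => i.
exact: measurable_slot.
Qed.

Section cluster_upper_bounds.
Context {R : realType} (n : nat) {dO : measure_display}
  {Omega : measurableType dO} (P : probability Omega R).
Hypothesis n_ge2 : (2 <= n)%N.
Variables (xi : Omega -> set ('rV[R]_n * R)) (nu : probability R R) (lambda : R).
Hypothesis lambda_gt0 : 0 < lambda.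
Hypothesis H : poisson_point_process P xi (boolean_intensity nu lambda).
Variable s : R.
Hypothesis s_gt0 : 0 < s.
Local Notation pt := ('rV[R]_n * R)%type.
Local Notation T := (scale n).
Local Notation mu := (boolean_intensity (d := n) nu lambda).
Let b : R := T%:R `^ s.
Let lambda_ge0 := ltW lambda_gt0.

Hypothesis escape_sum : (\sum_(j <oo) (b ^+ j)%:E * P (escape xi j) < +oo)%E.

Let Tgt0 k : 0 < T%:R ^+ k :> R.
Proof. exact: scaleX_gt0. Qed.

Let T_ge0 : 0 <= T%:R :> R.
Proof. by []. Qed.

Lemma scale_powR_gt1 : 1 < b.
Proof.
rewrite /b; have := @gt0_ltr_powR R s s_gt0 1 T%:R.
by rewrite powR1; apply; rewrite ?nnegrE// scale_gt1.
Qed.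

Let out_gt0 : 0 < out_ratio n :> R.
Proof. by rewrite mulr_gt0// ltr0n (leq_trans _ n_ge2). Qed.

Let out_scale_gt0 j : 0 < 2 * out_ratio n * T%:R ^+ j :> R.
Proof. by apply: mulr_gt0 (Tgt0 j); exact: mulr_gt0. Qed.

Let n_gt0 : (0 < n)%N := ltnW n_ge2.

Lemma escape_cluster j w : ~ escape xi j w ->
  origin_cluster (xi w) `<=` [set z | `|z| <= out_ratio n * T%:R ^+ j].
Proof.
move=> nesc y Cy /=; rewrite leNgt; apply/negP => yout; apply: nesc.
have [bw|nbw] := pselect (big_balls xi j w); [by left|right].
rewrite /scale_crossing /crossing/= shift0.
apply: (cluster_crosses n_ge2 _ _ Cy yout) => // q wq jq.
apply: le_trans (no_big_balls n_ge2 nbw wq jq).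
rewrite ler_wpM2r//; first by apply: le_trans jq; exact/ltW.
rewrite ler_peMr//; last by apply: ltW; exact: scale_gt1.
by rewrite /ctr_ratio; have := ler0n R n; lra.
Qed.

Lemma diam_moment_upper :
  (\int[P]_w (cluster_diam (xi w) `^ s) < +oo)%E.
Proof.
pose a : R := n%:R * (2 * out_ratio n).
have a0 : 0 < a by rewrite !mulr_gt0// ltr0n.
apply: (@integral_upper _ _ _ P _ (escape xi) b (a `^ s)) => //.
- exact: scale_powR_gt1.
- exact: powR_gt0.
- by move=> w; exact: poweR_ge0.
- exact: (measurable_escape H).
move=> j w /escape_cluster esc.
rewrite -powR_scale// ?(ltW a0)// -poweR_EFin poweR_le//; first exact: ltW.
  by apply: ereal_sup_ubound; left.
apply: ge_ereal_sup => _ [->|[x Cx [y Cy <-]]].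
  by rewrite lee_fin mulr_ge0// ?ltW.
rewrite lee_fin; apply: le_trans (enorm_le_norm _) _.
rewrite /a -mulrA ler_wpM2l// -mulrA mulr_natl mulr2n.
apply: le_trans (ler_normB _ _) _.
by apply: lerD; exact: esc.
Qed.

Lemma volume_moment_upper :
  (\int[P]_w (cluster_volume (xi w) `^ (s / n%:R)) < +oo)%E.
Proof.
(* Side of an open box of twice the radius of the closed box that contains the cluster. *)
pose a : R := 2 * (2 * out_ratio n).
have a0 : 0 < a by rewrite !mulr_gt0// ltr0n.
apply: (@integral_upper _ _ _ P _ (escape xi) b (a `^ s)) => //.
- exact: scale_powR_gt1.
- exact: powR_gt0.
- by move=> w; exact: poweR_ge0.
- exact: (measurable_escape H).
move=> j w /escape_cluster esc.
rewrite -powR_scale// ?(ltW a0)// -(@powR_root _ _ _ n)//; last first.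
  by rewrite mulr_ge0// ltW.
rewrite -poweR_EFin poweR_le//; first by rewrite divr_ge0// ltW.
have -> : a * T%:R ^+ j = 2 * (2 * out_ratio n * T%:R ^+ j) by rewrite /a !mulrA.
rewrite -lebesgue_open_box; last exact: out_scale_gt0.
apply: le_measure; rewrite ?inE.
- exact: (open_measurable_rV (@open_origin_cluster _ _ _)).
- exact: measurable_open_box.
- move=> z /esc /=; move=> /le_lt_trans; apply.
  by rewrite -mulrA mulr_natl mulr2n ltrDl; exact: (mulr_gt0 out_gt0 (Tgt0 j)).
Qed.

(** Confining the cluster does not bound its number of centers, so [E j] also contains the event
    that the box [B j] holds at least [N j] points, more than four times its mean. The Poisson tail
    is exponential in [(T ^ n) ^ j], hence summable against [b ^ j]. *)
Lemma card_moment_upper :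
  (\int[P]_w (cluster_card (xi w) `^ (s / n%:R)) < +oo)%E.
Proof.
pose B j : set pt :=
  [set z : 'rV[R]_n | `|z| < 2 * out_ratio n * T%:R ^+ j] `*` [set: R].
have r0 j : 0 < 2 * out_ratio n * T%:R ^+ j :> R by exact: out_scale_gt0.
have mB j : measurable (B j).
  by apply: measurableX => //; exact: measurable_open_box.
pose c : R := lambda * (4 * out_ratio n) ^+ n.
have c0 : 0 < c by rewrite mulr_gt0// exprn_gt0// mulr_gt0.
have muB j : mu (B j) = (c * (T%:R ^+ n) ^+ j)%:E.
  rewrite boolean_intensity_rect//; last exact: measurable_open_box.
  rewrite lebesgue_open_box// probability_setT mule1 -EFinM; congr EFin.
  by rewrite /c -[RHS]mulrA -exprM mulnC exprM -exprMn; congr (_ * _ ^+ _); ring.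
have Bfin j : (mu (B j) < +oo)%E by rewrite muB ltry.
have Tn1 : 1 < T%:R ^+ n :> R by rewrite exprn_egt1 -?lt0n// scale_gt1.
have Bgt0 j : 0 < fine (mu (B j)).
  by rewrite muB mulr_gt0// exprn_gt0// (lt_trans _ Tn1).
pose kappa : nat := (Num.trunc (4 * c)).+1.
pose N j := (kappa * (T ^ n) ^ j)%N.
have NE j : (N j)%:R = kappa%:R * (T%:R ^+ n) ^+ j :> R.
  by rewrite /N natrM !natrX.
pose E j := escape xi j `|` many xi (B j) (N j).
have mE j : measurable (E j).
  by apply: measurableU; [exact: (measurable_escape H)|exact: (measurable_many H)].
apply: (@integral_upper _ _ _ P _ E b (kappa%:R `^ (s / n%:R))) => //.
- exact: scale_powR_gt1.
- by apply: powR_gt0; rewrite ltr0n.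
- by move=> w; exact: poweR_ge0.
- move=> j w nE; have nesc : ~ escape xi j w by move=> ?; apply: nE; left.
  have nmany : ~ many xi (B j) (N j) w by move=> ?; apply: nE; right.
  have -> : kappa%:R `^ (s / n%:R) * b ^+ j = (N j)%:R `^ (s / n%:R).
    by rewrite NE powR_scale// powR_root.
  rewrite -poweR_EFin poweR_le//; first by rewrite divr_ge0// ltW.
  move/negP : nmany; rewrite -ltNge => /ltW; apply: le_trans.
  apply: counting_le => p [wp Cp]; split=> //; split=> //=.
  have := escape_cluster nesc Cp => /= /le_lt_trans; apply.
  by rewrite -mulrA mulr_natl mulr2n ltrDl; exact: (mulr_gt0 out_gt0 (Tgt0 j)).
have b0 j : (0 <= (b ^+ j)%:E)%E.
  by rewrite lee_fin exprn_ge0// ltW// (lt_trans _ scale_powR_gt1).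
apply: (@le_lt_trans _ _ (\sum_(j <oo) ((b ^+ j)%:E * P (escape xi j) +
    (b ^+ j)%:E * (expR (- (c * (T%:R ^+ n) ^+ j)))%:E))%E).
  apply: lee_nneseries => [j _ _|j _]; first by rewrite mule_ge0.
  rewrite -ge0_muleDr ?lee_fin ?expR_ge0//.
  rewrite lee_wpmul2l//; apply: le_trans (measureU2 _ _ _) _ => //.
  - exact: (measurable_escape H).
  - exact: (measurable_many H).
  rewrite leeD2l//; have -> : c * (T%:R ^+ n) ^+ j = fine (mu (B j)) by rewrite muB.
  apply: (prob_many_le H) => //.
  rewrite muB/= NE mulrA ler_wpM2r ?exprn_ge0//.
  exact/ltW/truncnS_gt.
rewrite nneseriesD => [|j _ _|j _ _]; last 2 first.
- by rewrite mule_ge0.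
- by rewrite mule_ge0// lee_fin expR_ge0.
rewrite lte_add_pinfty//; apply: sum_expr_expR => //.
exact: scale_powR_gt1.
Qed.

End cluster_upper_bounds.

(** * Lower bounds on the cluster *)

Section cluster_lower_bounds.
Context {R : realType} (n : nat) {dO : measure_display}
  {Omega : measurableType dO} (P : probability Omega R).
Hypothesis n_ge2 : (2 <= n)%N.
Variables (xi : Omega -> set ('rV[R]_n * R)) (nu : probability R R) (lambda : R).
Hypothesis lambda_gt0 : 0 < lambda.
Hypothesis H : poisson_point_process P xi (boolean_intensity nu lambda).
Variable s : R.
Hypothesis s_gt0 : 0 < s.
Local Notation pt := ('rV[R]_n * R)%type.
Local Notation T := (scale n).
Local Notation mu := (boolean_intensity (d := n) nu lambda).
Local Notation b := (T%:R `^ s).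
Let lambda_ge0 := ltW lambda_gt0.

Let Tgt0 k : 0 < T%:R ^+ k :> R.
Proof. exact: scaleX_gt0. Qed.

Let n_gt0 : (0 < n)%N := ltnW n_ge2.

(** Two points of [core k] are at Euclidean distance less than [n * (2 * rho * T ^ k)], which is
    [T ^ k]. *)
Let rho : R := (2 * n%:R)^-1.

Let rho_gt0 : 0 < rho.
Proof. by rewrite invr_gt0 mulr_gt0// ltr0n. Qed.

Let rhoT_gt0 k : 0 < rho * T%:R ^+ k.
Proof. by rewrite mulr_gt0. Qed.

Let b_gt1 : 1 < b.
Proof. exact: scale_powR_gt1. Qed.

Let bX_ge0 k : 0 <= b ^+ k.
Proof. by rewrite exprn_ge0// ltW// (lt_trans _ b_gt1). Qed.

Let bXe_ge0 k : (0 <= (b ^+ k)%:E)%E.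
Proof. by rewrite lee_fin. Qed.

Let kappa : R := lambda * (2 * rho) ^+ n.

Let kappa_gt0 : 0 < kappa.
Proof. by rewrite mulr_gt0// exprn_gt0// mulr_gt0. Qed.

Definition core k : set 'rV[R]_n := [set z | `|z| < rho * T%:R ^+ k].

Lemma measurable_core k : measurable (core k).
Proof. exact: measurable_open_box. Qed.

Lemma lebesgue_core k : lebesgue_rV n (core k) = ((2 * (rho * T%:R ^+ k)) ^+ n)%:E.
Proof. exact: lebesgue_open_box. Qed.

(* A point of [core k `*` layer k] is a ball of radius at least [T ^ k] that
   covers [core k], hence puts [core k] into the cluster of the origin. *)
Definition covering k : set pt := core k `*` layer n k.

Lemma measurable_covering k : measurable (covering k).
Proof. by apply: measurableX; [exact: measurable_core|exact: measurable_layer]. Qed.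

Lemma mu_core k (I : set R) : measurable I ->
  (mu (core k `*` I) = kappa%:E * (((T%:R ^+ k) ^+ n)%:E * nu I))%E.
Proof.
move=> mI; rewrite boolean_intensity_rect//; last exact: measurable_core.
rewrite lebesgue_core !muleA -!EFinM; congr (_%:E * _)%E.
by rewrite /kappa -[RHS]mulrA -exprMn; congr (_ * _ ^+ _); ring.
Qed.

Lemma core_cluster k w : occupies xi (covering k) w ->
  core k `<=` origin_cluster (xi w).
Proof.
move=> [q [wq [/= qk]]]; rewrite /layer/= in_itv/= => /andP[kq _].
have core_ball : core k `<=` eball q.1 q.2.
  move=> z; rewrite /core/eball/= => zk.
  apply: le_lt_trans (enorm_le_norm _) _; apply: lt_le_trans kq.
  apply: (@lt_le_trans _ _ (n%:R * (2 * (rho * T%:R ^+ k)))).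
    rewrite ltr_pM2l ?ltr0n//; apply: le_lt_trans (ler_normB _ _) _.
    by move: zk qk; rewrite /core/=; lra.
  by rewrite /rho !mulrA [n%:R * 2]mulrC divff ?mul1r// mulf_neq0 ?pnatr_eq0// -lt0n.
apply: connected_component_max.
- by rewrite /core/= normr0.
- by apply: subset_trans core_ball _; exact: eball_sub_boolean_set.
apply: (@connected_star _ _ 0) => y t; rewrite /core/= subr0 add0r normrZ => yr.
move=> /andP[t0 t1]; rewrite ger0_norm//; apply: le_lt_trans yr.
by rewrite -[leRHS]mul1r ler_wpM2r.
Qed.

Let v k := fine (mu (covering k)).

Let v_ge0 k : 0 <= v k.
Proof. by apply: fine_ge0; exact: boolean_intensity_ge0. Qed.

Let covering_fin k : (mu (covering k) < +oo)%E.
Proof.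
apply: boolean_intensity_lty => //; exact: measurable_layer.
Qed.

Let vE k : mu (covering k) = (v k)%:E.
Proof. by rewrite fineK// ge0_fin_numE// boolean_intensity_ge0. Qed.

(** From probabilities [p = 1 - expR (- v)] back to means [v]: when [p <= 1 / 2], the inequality
    [1 + v <= expR v = 1 / (1 - p)] gives [v <= 2 * p]. The remaining indices are finitely many,
    with finite means. *)
Lemma covering_sum k0 :
  (\sum_(k <oo) (b ^+ k)%:E *
     (if (k0 <= k)%N then P (occupies xi (covering k)) else 0) < +oo)%E ->
  (\sum_(k <oo) (b ^+ k)%:E * mu (covering k) < +oo)%E.
Proof.
have b0 : 0 < b by apply: lt_trans b_gt1.
pose p k := 1 - expR (- v k).
have pE k : P (occupies xi (covering k)) = (p k)%:E.
  apply: (prob_occupies H) => //; last exact: measurable_covering.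
  by move=> A; exact: boolean_intensity_ge0.
have p0 k : 0 <= p k by rewrite subr_ge0 -expR0 ler_expR oppr_le0.
have vp k : p k <= 2^-1 -> v k <= 2 * p k.
  move=> pk; have := expR_ge1Dx (v k); have := expRxMexpNx_1 (v k).
  rewrite /p in pk *; have := v_ge0 k; set e := expR (- v k) in pk *.
  set f := expR (v k) => v0 fe fv.
  have e0 : 0 < e by exact: expR_gt0.
  have : (1 + v k) * e <= f * e by apply: ler_wpM2r fv; exact: ltW.
  by rewrite fe; nra.
set S := (\sum_(_ <oo) _)%E => Sfin.
have term0 k : (0 <= (b ^+ k)%:E *
    (if (k0 <= k)%N then P (occupies xi (covering k)) else 0))%E.
  by rewrite mule_ge0//; case: ifP.
have S0 : (0 <= S)%E by exact: nneseries_ge0.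
pose M := fine S; have ME : S = M%:E by rewrite fineK// ge0_fin_numE.
have M0 : 0 <= M by exact: fine_ge0.
have partial N : \sum_(0 <= k < N) b ^+ k * (if (k0 <= k)%N then p k else 0) <= M.
  rewrite -lee_fin -ME; apply: le_trans (nneseries_lim_ge N _); last by [].
  rewrite -sumEFin; apply: lee_sum => k _; rewrite EFinM pE.
  by case: ifP.
(* A single term is at most [M], so a weight of at least [2 * M] forces [p k <= 1 / 2]. *)
have [k1 k1M] := expr_unbounded (2 * M) b_gt1.
pose K := maxn k0 k1.
have vK k : (K <= k)%N -> v k <= 2 * p k.
  rewrite geq_max => /andP[k0k k1k]; apply: vp.
  have bp : b ^+ k * p k <= M.
    apply: le_trans (partial k.+1); rewrite big_nat_recr//= k0k lerDr.
    apply: sumr_ge0 => j _; rewrite mulr_ge0//.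
    by case: ifP.
  have bk : 2 * M <= b ^+ k.
    by apply: le_trans k1M _; rewrite ler_weXn2l// ltW.
  have bk0 : 0 < b ^+ k by rewrite exprn_gt0.
  by rewrite -(ler_pM2l bk0); apply: le_trans bp _; rewrite ler_pdivlMr//; lra.
apply: (@le_lt_trans _ _ (\sum_(0 <= k < K) b ^+ k * v k + 2 * M)%:E); last first.
  by rewrite ltry.
apply: nneseries_le_partial => [k|N].
  by rewrite vE mule_ge0// lee_fin.
under eq_bigr do rewrite vE -EFinM.
have bv0 k : 0 <= b ^+ k * v k by rewrite mulr_ge0.
rewrite sumEFin lee_fin; apply: (@le_trans _ _ (\sum_(0 <= k < K + N) b ^+ k * v k)).
  by rewrite [leRHS](big_cat_nat (n := N)) ?leq_addl//= lerDl sumr_ge0.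
rewrite (big_cat_nat (n := K)) ?leq_addr//= lerD2l.
apply: (@le_trans _ _ (2 * \sum_(K <= k < K + N)
    b ^+ k * (if (k0 <= k)%N then p k else 0))).
  rewrite mulr_sumr big_nat_cond [leRHS]big_nat_cond; apply: ler_sum => k.
  move=> /andP[/andP[Kk _] _]; have := Kk; rewrite geq_max => /andP[-> _].
  by rewrite mulrCA ler_wpM2l ?vK.
rewrite ler_wpM2l//; apply: le_trans (partial (K + N)%N).
rewrite [leRHS](big_cat_nat (n := K)) ?leq_addr//= lerDr sumr_ge0// => k _.
by rewrite mulr_ge0//; case: ifP.
Qed.

Lemma covering_sum_layers :
  (\sum_(k <oo) (b ^+ k)%:E * mu (covering k) < +oo)%E ->
  (\sum_(k <oo) (b ^+ k)%:E * (((T%:R ^+ k) ^+ n)%:E * nu (layer n k)) < +oo)%E.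
Proof.
have b0 : 0 < b by apply: lt_trans b_gt1.
have t0 k : (0 <= (b ^+ k)%:E * (((T%:R ^+ k) ^+ n)%:E * nu (layer n k)))%E.
  by rewrite !mule_ge0// lee_fin exprn_ge0// ltW.
under eq_eseriesr => k _.
  rewrite mu_core; last exact: measurable_layer.
  by rewrite muleCA; over.
rewrite nneseriesZl//.
set S := (\sum_(_ <oo) _)%E; have [->|Sn _] := eqVneq S +oo%E.
  by rewrite gt0_muley ?lte_fin// ltxx.
by rewrite ltey.
Qed.

(** The factor [2^-1] leaves room to intersect the covering event with an independent event of
    probability at least one half, and [k0] leaves room for asymptotic estimates, as the cardinality
    requires. *)
Lemma lower_moment (X : Omega -> \bar R) (c : R) k0 (E : (set Omega)^nat) :
  0 < c -> (forall w, 0 <= X w)%E ->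
  (forall k, (k0 <= k)%N -> measurable (E k)) ->
  (forall k w, (k0 <= k)%N -> E k w -> (c * b ^+ k)%:E <= X w)%E ->
  (forall k, (k0 <= k)%N ->
     2^-1%:E * P (occupies xi (covering k)) <= P (E k))%E ->
  (\int[P]_w X w < +oo)%E ->
  (\sum_(k <oo) (b ^+ k)%:E * (((T%:R ^+ k) ^+ n)%:E * nu (layer n k)) < +oo)%E.
Proof.
move=> c0 X0 mE XE PE intX.
have b0 : 0 < b by apply: lt_trans b_gt1.
pose E' k := if (k0 <= k)%N then E k else set0.
have sE : (\sum_(k <oo) (b ^+ k)%:E * P (E' k) < +oo)%E.
  apply: (integral_lower b_gt1 c0 X0) intX => k; rewrite /E'.
    by case: ifP => // kk; exact: mE.
  by move=> w; case: ifP => // kk; exact: XE.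
apply: covering_sum_layers; apply: (@covering_sum k0).
apply: (@le_lt_trans _ _ (\sum_(k <oo) 2%:E * ((b ^+ k)%:E * P (E' k)))%E).
  apply: lee_nneseries => [k _ _|k _].
    by rewrite mule_ge0//; case: ifP.
  rewrite muleCA lee_wpmul2l// /E'.
  case: ifP => kk; last by rewrite measure0 mule0.
  have two0 : (0 <= 2%:E :> \bar R)%E by rewrite lee_fin.
  have := lee_wpmul2l two0 (PE k kk).
  by rewrite muleA -EFinM divff// mul1e.
rewrite nneseriesZl; last first.
  by move=> k _; rewrite mule_ge0.
by rewrite lte_mul_pinfty// nneseries_ge0// => k _ _; rewrite mule_ge0.
Qed.

Let covering_moment (X : Omega -> \bar R) (c : R) :
  0 < c -> (forall w, 0 <= X w)%E ->
  (forall k w, occupies xi (covering k) w -> (c * b ^+ k)%:E <= X w)%E ->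
  (\int[P]_w X w < +oo)%E ->
  (\sum_(k <oo) (b ^+ k)%:E * (((T%:R ^+ k) ^+ n)%:E * nu (layer n k)) < +oo)%E.
Proof.
move=> c0 X0 Xc; apply: (lower_moment (k0 := 0) c0 X0) => [k _|k w _|k _].
- exact: (measurable_occupies H (measurable_covering k)).
- exact: Xc.
- by rewrite -[leRHS]mul1e lee_wpmul2r// lee_fin invf_le1// ler1n.
Qed.

Lemma diam_moment_lower : (\int[P]_w (cluster_diam (xi w) `^ s) < +oo)%E ->
  (\sum_(k <oo) (b ^+ k)%:E * (((T%:R ^+ k) ^+ n)%:E * nu (layer n k)) < +oo)%E.
Proof.
have r2 : 0 < rho / 2 by rewrite divr_gt0.
apply: (@covering_moment _ ((rho / 2) `^ s)); first exact: powR_gt0.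
  by move=> w; exact: poweR_ge0.
move=> k w /core_cluster cC.
have rk0 : 0 <= rho / 2 * T%:R ^+ k by rewrite mulr_ge0// ltW.
rewrite -powR_scale ?(ltW r2)// -poweR_EFin poweR_le//; first exact: ltW.
pose x : 'rV[R]_n := const_mx (rho / 2 * T%:R ^+ k).
have Cx : origin_cluster (xi w) x.
  apply: cC; apply: norm_rV_lt => [|i]; first exact: rhoT_gt0.
  rewrite mxE ger0_norm// ltr_pM2r// ltr_pdivrMr//.
  by rewrite ltr_pMr// ltr1n.
have C0 : origin_cluster (xi w) 0 by apply: cC; rewrite /core/= normr0 rhoT_gt0.
apply: (@le_trans _ _ (enorm (x - 0))%:E).
  rewrite lee_fin subr0; apply: le_trans (norm_le_enorm _).
  have := norm_coord_le x (Ordinal n_gt0); rewrite mxE.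
  by apply: le_trans; exact: ler_norm.
by apply: ereal_sup_ubound; right; exists x => //; exists 0.
Qed.

Lemma volume_moment_lower :
  (\int[P]_w (cluster_volume (xi w) `^ (s / n%:R)) < +oo)%E ->
  (\sum_(k <oo) (b ^+ k)%:E * (((T%:R ^+ k) ^+ n)%:E * nu (layer n k)) < +oo)%E.
Proof.
have r2 : 0 < 2 * rho by rewrite mulr_gt0.
apply: (@covering_moment _ ((2 * rho) `^ s)); first exact: powR_gt0.
  by move=> w; exact: poweR_ge0.
move=> k w /core_cluster cC.
rewrite -powR_scale ?(ltW r2)// -(@powR_root _ _ _ n)//; last first.
  by rewrite mulr_ge0// ltW.
rewrite -poweR_EFin poweR_le//; first by rewrite divr_ge0// ltW.
  by rewrite lee_fin exprn_ge0// mulr_ge0// ltW.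
rewrite -mulrA -lebesgue_core; apply: le_measure; rewrite ?inE//.
- exact: measurable_core.
- exact: (open_measurable_rV (@open_origin_cluster _ _ _)).
Qed.

(** The covering ball brings the whole core into the cluster, but points are needed there. Those
    with radius below [T ^ k] are independent of [covering k], and for large [k] they have a mean of
    order [(T ^ n) ^ k], since [nu (J k)] tends to 1. *)
Lemma card_moment_lower :
  (\int[P]_w (cluster_card (xi w) `^ (s / n%:R)) < +oo)%E ->
  (\sum_(k <oo) (b ^+ k)%:E * (((T%:R ^+ k) ^+ n)%:E * nu (layer n k)) < +oo)%E.
Proof.
pose J k : set R := `]-oo, (T%:R ^+ k)[%classic.
have mJ k : measurable (J k) by exact: measurable_itv.
pose G k : set pt := core k `*` J k.
have mG k : measurable (G k) by apply: measurableX => //; exact: measurable_core.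
have [k1 nuJ] : exists k1, forall k, (k1 <= k)%N -> (2^-1%:E <= nu (J k))%E.
  have nuT : nu (J k) @[k --> \oo] --> 1%E.
    rewrite -(probability_setT nu) -(_ : \bigcup_k J k = setT).
      apply: nondecreasing_cvg_mu => //; first exact: bigcup_measurable.
      move=> i j ij; apply/subsetPset => x; rewrite /J/= !in_itv/= => xi'.
      apply: lt_le_trans xi' _; rewrite ler_weXn2l// ltW//; exact: scale_gt1.
    apply/seteqP; split=> // x _.
    have [k xk] := expr_unbounded (x + 1) (scale_gt1 n_ge2 : 1 < T%:R :> R).
    by exists k => //; rewrite /J/= in_itv/=; move: xk; lra.
  have : \forall k \near \oo, (2^-1%:E < nu (J k))%E.
    apply: (nuT [set x | 2^-1%:E < x]%E); apply: open_nbhs_nbhs.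
    split; first exact: open_ereal_gt_ereal.
    by rewrite /= lte_fin invf_lt1// ltr1n.
  by move=> [k1 _ k1P]; exists k1 => k /k1P /ltW.
have T1 := @scale_gt1 R n n_ge2.
have Tn1 : 1 < T%:R ^+ n :> R by rewrite exprn_egt1 -?lt0n.
(* Makes [kappa / 2 * (T ^ n) ^ k], a lower bound of the mean, at least 8. *)
have [k2 Tk2] := expr_unbounded (16 / kappa) Tn1.
pose m k := fine (mu (G k)).
have Gfin k : (mu (G k) < +oo)%E by exact: boolean_intensity_lty.
have mE k : mu (G k) = (m k)%:E.
  by rewrite fineK// ge0_fin_numE// boolean_intensity_ge0.
have mge k : (maxn k1 k2 <= k)%N ->
    8 <= m k /\ kappa / 2 * (T%:R ^+ n) ^+ k <= m k.
  rewrite geq_max => /andP[/nuJ kk1 kk2].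
  have h : kappa / 2 * (T%:R ^+ n) ^+ k <= m k.
    have -> : kappa / 2 * (T%:R ^+ n) ^+ k = kappa * ((T%:R ^+ k) ^+ n * 2^-1).
      by rewrite -!exprM (mulnC k); ring.
    rewrite -lee_fin -mE mu_core//.
    have -> : (kappa * ((T%:R ^+ k) ^+ n * 2^-1))%:E =
      (kappa%:E * (((T%:R ^+ k) ^+ n)%:E * 2^-1%:E))%E by [].
    apply: lee_wpmul2l; first by rewrite lee_fin ltW.
    apply: lee_wpmul2l; first by rewrite lee_fin exprn_ge0.
    exact: kk1.
  split=> //; apply: le_trans h.
  have : 16 / kappa <= (T%:R ^+ n) ^+ k.
    by apply: le_trans Tk2 _; rewrite ler_weXn2l// ltW.
  by rewrite ler_pdivrMr//; lra.
(* As [m k >= 8], truncation leaves at least [m k / 4 - 1 >= m k / 8], hence at least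
   [kappa / 16 * (T ^ n) ^ k]. *)
pose N k := Num.trunc (m k / 4).
apply: (@lower_moment _ ((kappa / 16) `^ (s / n%:R)) (maxn k1 k2)
  (fun k => occupies xi (covering k) `&` many xi (G k) (N k))).
- by rewrite powR_gt0// divr_gt0.
- by move=> w; exact: poweR_ge0.
- move=> k _; apply: measurableI; last exact: (measurable_many H).
  exact: (measurable_occupies H (measurable_covering k)).
- move=> k w /mge[m8 mk] [/core_cluster cC manyk].
  have -> : b ^+ k = ((T%:R ^+ n) `^ (s / n%:R)) ^+ k by rewrite powR_root.
  rewrite -powR_scale; [|by rewrite divr_ge0// ltW|by rewrite exprn_ge0].
  rewrite -poweR_EFin poweR_le//; first by rewrite divr_ge0// ltW.
    by rewrite lee_fin mulr_ge0 ?exprn_ge0// divr_ge0// ltW.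
  apply: (@le_trans _ _ (N k)%:R%:E).
    have := truncnS_gt (m k / 4); rewrite -/(N k) -[(N k).+1]addn1 natrD lee_fin.
    by move: m8 mk; lra.
  apply: le_trans manyk _; apply: counting_le => q [wq [qk _]].
  by split=> //; exact: cC.
- move=> k /mge[m8 mk].
  have -> : P (occupies xi (covering k) `&` many xi (G k) (N k)) =
      (P (occupies xi (covering k)) * P (many xi (G k) (N k)))%E.
    pose A (i : bool) := if i then covering k else G k.
    pose B (i : bool) : set (\bar R) := if i then ~` [set 0%E]
      else `[(N k)%:R%:E, +oo[%classic.
    have manyE : many xi (G k) (N k) = npoints xi (G k) @^-1` B false.
      by apply/seteqP; split=> w; rewrite /many/= in_itv/= ?andbT.
    have := @npoints_independent _ _ _ _ P xi _ H bool A B.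
    rewrite big_bool/= -manyE -[_ @^-1` ~` _]occupiesE => <-.
    + congr (P _); apply/seteqP; split=> [w [w1 w2] [] _|w wAB].
      * by move: w1; rewrite occupiesE.
      * by move: w2; rewrite manyE.
      * by split; [rewrite occupiesE; exact: (wAB true)|rewrite manyE; exact: (wAB false)].
    + by case; [exact: measurable_covering|exact: mG].
    + move=> [] [] _ _ //= [q [[_ +] [_ +]]]; rewrite /layer /J/= !in_itv/=.
        by move=> /andP[+ _]; rewrite leNgt => /negP.
      by move=> + /andP[+ _]; rewrite leNgt => + /negP.
    + by case=> /=; [exact: measurableC|exact: emeasurable_itv].
  rewrite muleC; apply: lee_wpmul2l => //.
  have m0 : 0 < m k by apply: lt_le_trans m8.
  have m4 : 4 <= m k by apply: le_trans m8; rewrite ler_nat.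
  have mN : 4 * (N k)%:R <= m k.
    have /truncn_itv/andP[+ _] : 0 <= m k / 4 by rewrite divr_ge0// ltW.
    by rewrite -/(N k); lra.
  exact: (prob_many_ge H (mG k) (Gfin k) m0 m4 mN).
Qed.

End cluster_lower_bounds.

(** * Paths and chains *)

Section paths.
Context {R : realType} (n : nat).
Implicit Types (S A B : set 'rV[R]_n) (x y z : 'rV[R]_n).

Lemma continuous_comp_affine (V : normedModType R) (f : R -> V) (a c : R) :
  continuous f -> continuous (fun t : R => f (a * t + c)).
Proof.
move=> cf t; have ca : {for t, continuous (fun t : R => a * t + c)}.
  by apply: cvgD; [exact: mulrl_continuous|exact: cvg_cst].
exact: continuous_comp ca (cf _).
Qed.

Definition clamp (t : R) : R := Num.max 0 (Num.min 1 t).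

Lemma clamp0 t : t <= 0 -> clamp t = 0.
Proof.
by move=> t0; rewrite /clamp min_r ?max_l// (le_trans t0).
Qed.

Lemma clamp1 t : 1 <= t -> clamp t = 1.
Proof. by move=> t1; rewrite /clamp min_l ?max_r. Qed.

Lemma clamp_itv t : 0 <= clamp t <= 1.
Proof. by rewrite /clamp le_max lexx ge_max ler01 ge_min lexx. Qed.

Lemma continuous_clamp : continuous clamp.
Proof.
move=> t; have ct (a : R^o) : {for t, continuous (cst a : R -> R^o)}.
  exact: cst_continuous.
have it : {for t, continuous (id : R -> R^o)} by move=> ?.
exact: (continuous_max (ct 0) (continuous_min (ct 1) it)).
Qed.

(* Requiring a path on the whole line, and not only on [0, 1], lets paths be
   concatenated by a formula, without pasting on closed pieces. *)
Definition joined S x y := exists f : R -> 'rV[R]_n,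
  [/\ continuous f, f 0 = x, f 1 = y & forall t, S (f t)].

Lemma joined_sub S S' x y : S `<=` S' -> joined S x y -> joined S' x y.
Proof. by move=> SS [f [cf f0 f1 fS]]; exists f; split=> // t; exact: SS. Qed.

Lemma joined_sym S x y : joined S x y -> joined S y x.
Proof.
move=> [f [cf f0 f1 fS]]; exists (fun t => f (-1 * t + 1)); split.
- exact: continuous_comp_affine.
- by rewrite mulr0 add0r.
- by rewrite mulr1 addNr.
- by [].
Qed.

Lemma joined_trans S x y z : joined S x y -> joined S y z -> joined S x z.
Proof.
move=> [f [cf f0 f1 fS]] [g [cg g0 g1 gS]].
have cc (h : R -> 'rV[R]_n) : continuous h -> continuous (h \o clamp).
  by move=> ch t; apply: continuous_comp; [exact: continuous_clamp|exact: ch].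
(* On each half of the line one of the two clamped terms is constant: first [g - g 0] vanishes, then
   [f] stays at [y = g 0]. *)
exists (fun t => (f \o clamp) (2 * t + 0) + ((g \o clamp) (2 * t + -1) - g 0)).
split => /=.
- have c1 := continuous_comp_affine (a := 2) (c := 0) (cc _ cf).
  have c2 := continuous_comp_affine (a := 2) (c := -1) (cc _ cg).
  by move=> t; apply: cvgD; [exact: c1|apply: cvgB; [exact: c2|exact: cvg_cst]].
- by rewrite mulr0 addr0 add0r !clamp0// subrr addr0.
- rewrite mulr1 addr0 clamp1 ?ler1n// (_ : 2 - 1 = 1) ?clamp1//; last by ring.
  by rewrite f1 g0 g1 addrC subrK.
move=> t; rewrite addr0; have [t2|t2] := leP (2 * t) 1.
  by rewrite (clamp0 (_ : 2 * t - 1 <= 0)) ?subr_le0// subrr addr0.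
by rewrite (clamp1 (ltW t2)) f1 g0 addrC subrK.
Qed.

Lemma joined_star S c y : star_shaped c S -> S y -> joined S c y.
Proof.
move=> cS Sy; exists (fun t => c + clamp t *: (y - c)); split.
- move=> t; apply: (@continuous_comp _ _ _ clamp (fun t => c + t *: (y - c))).
    exact: continuous_clamp.
  exact: continuous_line.
- by rewrite clamp0// scale0r addr0.
- by rewrite clamp1// scale1r addrC subrK.
- by move=> t; apply: cS => //; exact: clamp_itv.
Qed.

Lemma joined_eball c r x y : eball c r x -> eball c r y ->
  joined (eball c r) x y.
Proof.
move=> xc yc; have st := @star_eball R n c r.
exact: joined_trans (joined_sym (joined_star st xc)) (joined_star st yc).
Qed.

Lemma chained_joined (X : set ('rV[R]_n * R)) A p y : chained X A p ->
  eball p.1 p.2 y -> exists2 a, A a & joined (boolean_set X) a y.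
Proof.
move=> pX; elim: pX y => [{}p Xp [a [pa Aa]]|{}p q _ IH Xq [z [qz pz]]] y py.
  exists a => //; apply: joined_sub (joined_eball pa py).
  exact: eball_sub_boolean_set.
have [a Aa az] := IH z pz; exists a => //; apply: joined_trans az _.
by apply: joined_sub (joined_eball qz py); exact: eball_sub_boolean_set.
Qed.

Lemma crosses_joined (X : set ('rV[R]_n * R)) A B : crosses X A B ->
  exists a b, [/\ A a, B b & joined (boolean_set X) a b].
Proof.
move=> [p pX [b [pb Bb]]]; have [a Aa ab] := chained_joined pX pb.
by exists a, b.
Qed.

(** The image of a path is connected, so [connected_chained] applies to it; conversely balls are
    path connected. The events in [Lambda_hat] thus become crossing events, hence measurable. *)
Lemma path_crosses (X : set ('rV[R]_n * R)) A B :
  path_between (boolean_set X) A B <-> crosses X A B.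
Proof.
split=> [[f [cf fX f0 f1]]|/crosses_joined[a [b [Aa Bb [f [cf f0 f1 fX]]]]]].
  have i0 : `[0, 1]%classic (0 : R) by rewrite /= in_itv/= lexx ler01.
  have i1 : `[0, 1]%classic (1 : R) by rewrite /= in_itv/= lexx ler01.
  have [||||p pX pf1] := @connected_chained R n X (f @` `[0, 1]%classic) (f 0) (f 1).
  - apply: connected_continuous_connected => //; exact: segment_connected.
  - by move=> _ [t t01 <-]; exact: fX.
  - by exists 0.
  - by exists 1.
  exists p; last by exists (f 1).
  by apply: chained_sub pX => // _ ->.
exists f; split; rewrite ?f0 ?f1//.
exact: continuous_subspaceT.
Qed.

(** Intermediate values of the Euclidean norm give times at [r] and [2 * r]. The joining map stays
    in the covered set on the whole line, so an affine change of time connects these two times in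
    either order. *)
Lemma crosses_spheres (X : set ('rV[R]_n * R)) A B (r : R) :
  (forall z, A z -> enorm z <= r) -> (forall z, B z -> 2 * r <= enorm z) ->
  0 <= r -> crosses X A B ->
  crosses X (esphere r) (esphere (2 * r)).
Proof.
move=> Ar Br r0 /crosses_joined[a [c [/Ar ar /Br cr [f [cf f0 f1 fX]]]]].
pose g t := enorm (f t).
have cg : continuous g.
  by move=> t; apply: continuous_comp; [exact: cf|exact: continuous_enorm].
have ivt v : r <= v <= 2 * r -> exists2 t, t \in `[0, 1] & g t = v.
  move=> /andP[rv vr]; apply: IVT => //; first exact: continuous_subspaceT.
  rewrite /g f0 f1 ge_min le_max (le_trans ar rv)/=.
  by rewrite (le_trans vr cr) orbT.
have [t1 t1i gt1] : exists2 t, t \in `[0, 1] & g t = r.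
  by apply: ivt; rewrite lexx; lra.
have [t2 t2i gt2] : exists2 t, t \in `[0, 1] & g t = 2 * r.
  by apply: ivt; rewrite lexx andbT; lra.
apply/path_crosses; exists (fun t => f ((t2 - t1) * t + t1)); split => //.
- by apply: continuous_subspaceT; exact: continuous_comp_affine.
- by rewrite /esphere/= mulr0 add0r.
- by rewrite /esphere/= mulr1 subrK.
Qed.

End paths.

(** * Paths between spheres and crossing probabilities *)

Section connectivity.
Context {R : realType} (n : nat) {dO : measure_display}
  {Omega : measurableType dO} (P : probability Omega R).
Hypothesis n_ge2 : (2 <= n)%N.
Variables (xi : Omega -> set ('rV[R]_n * R)) (nu : probability R R) (lambda : R).
Hypothesis lambda_gt0 : 0 < lambda.
Hypothesis H : poisson_point_process P xi (boolean_intensity nu lambda).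
Local Notation T := (scale n).

Definition sphere_path (r : R) : set Omega :=
  [set w | path_between (boolean_set (xi w)) (esphere r) (esphere (2 * r))].

Lemma measurable_sphere_path r : measurable (sphere_path r).
Proof.
have -> : sphere_path r =
    crossing xi [set: 'rV[R]_n * R] (esphere r) (esphere (2 * r)) 0.
  by apply/seteqP; split=> w; rewrite /sphere_path /crossing/= setIT shift0
    path_crosses.
exact: (measurable_crossing H _ _ openT).
Qed.

Lemma scale_crossing_path j :
  scale_crossing xi j `<=` sphere_path (n%:R * T%:R ^+ j).
Proof.
move=> w; rewrite /scale_crossing /crossing /sphere_path/= shift0 path_crosses => cw.
have Tj : 0 < T%:R ^+ j :> R by exact: scaleX_gt0.
have {}cw : crosses (xi w) (inner (T%:R ^+ j)) (outer (T%:R ^+ j)).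
  by apply: crosses_sub cw => // p [].
apply: crosses_spheres cw.
- move=> z zin; apply: le_trans (enorm_le_norm _) _.
  by rewrite ler_wpM2l.
- move=> z; rewrite /outer/out_ratio/= mulrA => /ltW/le_trans; apply.
  exact: norm_le_enorm.
- by rewrite mulr_ge0// ltW.
Qed.

Lemma crossing_prob_eventually_small (e : R) : 0 < e ->
  P (sphere_path r) @[r --> +oo] --> 0%E ->
  exists j0, forall j, (j0 <= j)%N -> crossing_prob P xi j <= e.
Proof.
move=> e0 cv; have : \forall r \near +oo, (P (sphere_path r) < e%:E)%E.
  apply: (cv [set x | x < e%:E]%E); apply: open_nbhs_nbhs; split.
    exact: open_ereal_lt_ereal.
  by rewrite /= lte_fin.
move=> [M [_ MP]].
have [j0 j0M] := expr_unbounded (Num.max M 0 + 1) (scale_gt1 n_ge2 : 1 < T%:R :> R).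
exists j0 => j jj.
have Tj : M < n%:R * T%:R ^+ j.
  have h : Num.max M 0 + 1 <= T%:R ^+ j.
    apply: le_trans j0M _; rewrite ler_weXn2l// ltW//; exact: scale_gt1.
  have n1 : 1 <= n%:R :> R by rewrite ler1n ltnW.
  have M1 : M <= Num.max M 0 by rewrite le_max lexx.
  have M2 : 0 <= Num.max M 0 by rewrite le_max lexx orbT.
  by nra.
rewrite -lee_fin -(crossing_probE H); apply/ltW.
apply: le_lt_trans (MP _ Tj); apply: le_measure; rewrite ?inE.
- exact: (measurable_scale_crossing H).
- exact: measurable_sphere_path.
- exact: scale_crossing_path.
Qed.

End connectivity.

(** * The moment of the radius *)

Section radius.
Context {R : realType} (n : nat) {dQ : measure_display}
  {Q_space : measurableType dQ} (Q : probability Q_space R).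
Hypothesis n_ge2 : (2 <= n)%N.
Variables (rad : {RV Q >-> R}) (nu : probability R R).
Hypothesis rad_nu : forall A : set R, measurable A -> distribution Q rad A = nu A.
Variable s : R.
Hypothesis s_gt0 : 0 < s.
Local Notation T := (scale n).
Local Notation b := (T%:R `^ s).
Local Notation X := (fun q => ((rad q `^ (n%:R + s))%R)%:E).

Definition layers_sum : \bar R :=
  (\sum_(k <oo) (b ^+ k)%:E * (((T%:R ^+ k) ^+ n)%:E * nu (layer n k)))%E.

(** As [B = b * T ^ n], the layer series is the sum of [B ^ k] against the law of the radius, a
    discretized moment of order [n + s]. *)
Let B : R := T%:R `^ (n%:R + s).

Let T_gt1 : 1 < T%:R :> R.
Proof. exact: scale_gt1. Qed.

Let ns_gt0 : 0 < n%:R + s.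
Proof. by rewrite ltr_wpDl. Qed.

Let B_gt1 : 1 < B.
Proof.
have := @gt0_ltr_powR R (n%:R + s) ns_gt0 1 T%:R.
by rewrite powR1; apply; rewrite ?nnegrE.
Qed.

Let BE k : B ^+ k = b ^+ k * (T%:R ^+ k) ^+ n.
Proof.
rewrite /B powRD; last by rewrite (_ : T%:R != 0) ?implybT// gt_eqF// (lt_trans _ T_gt1).
by rewrite exprMn powR_mulrn// mulrC -!exprM mulnC.
Qed.

Let E k := rad @^-1` layer n k.

Let mE k : measurable (E k).
Proof.
by rewrite -[X in measurable X]setTI; apply: measurable_funPT => //;
  exact: measurable_layer.
Qed.

Let QE k : Q (E k) = nu (layer n k).
Proof. by rewrite -rad_nu//; exact: measurable_layer. Qed.

Let layers_sumE : layers_sum = (\sum_(k <oo) (B ^+ k)%:E * Q (E k))%E.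
Proof.
by apply: eq_eseriesr => k _; rewrite QE BE EFinM muleA.
Qed.

Lemma radius_layers : ('E_Q[fun q => (rad q `^ (n%:R + s))%R] < +oo)%E ->
  (layers_sum < +oo)%E.
Proof.
rewrite unlock layers_sumE => XQ.
apply: (integral_lower B_gt1 ltr01 _ mE) XQ => [q|k q]; first by rewrite lee_fin powR_ge0.
rewrite /E/layer/= in_itv/= => /andP[kr _]; rewrite mul1r lee_fin.
have Tk0 : 0 <= T%:R ^+ k :> R by rewrite exprn_ge0.
rewrite -powR_expr//; apply: ge0_ler_powR => //; rewrite ?nnegrE//.
  exact: ltW.
exact: le_trans kr.
Qed.

(** [integral_upper] asks for events outside which the radius is bounded, hence the tails [F];
    [weighted_tails] brings them back to single layers. *)
Lemma layers_radius : (layers_sum < +oo)%E ->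
  ('E_Q[fun q => (rad q `^ (n%:R + s))%R] < +oo)%E.
Proof.
rewrite unlock layers_sumE => sumE.
have B0 : 0 < B by apply: lt_trans B_gt1.
pose F j := \bigcup_k (if (j <= k)%N then E k else set0).
have mF' j k : measurable (if (j <= k)%N then E k else set0) by case: ifP.
have mF j : measurable (F j) by exact: bigcup_measurable.
apply: (@integral_upper _ _ _ Q X F B 1) => //.
- by move=> q; rewrite lee_fin powR_ge0.
- move=> j q nF; rewrite mul1r lee_fin.
  have rj : rad q < T%:R ^+ j.
    rewrite ltNge; apply/negP => /(layer_ex n_ge2)[k jk kq].
    by apply: nF; exists k => //; rewrite jk.
  have Tj0 : 0 <= T%:R ^+ j :> R by rewrite exprn_ge0.
  have [r0|r0] := leP 0 (rad q).
    by rewrite -powR_expr//; apply: ge0_ler_powR; rewrite ?nnegrE// ltW.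
  (* On a negative base [ln] is 0, so the power takes the value 1. *)
  rewrite /powR (lt_eqF r0) (ln0 (ltW r0)) mulr0 expR0.
  by apply: exprn_ege1; exact: ltW.
apply: (@le_lt_trans _ _ ((B / (B - 1))%:E * (\sum_(k <oo) (B ^+ k)%:E * Q (E k)))%E).
  apply: le_trans (weighted_tails B_gt1 (fun k => measure_ge0 Q (E k))).
  apply: lee_nneseries => [j _ _|j _].
    by rewrite mule_ge0// lee_fin exprn_ge0// ltW.
  apply: lee_wpmul2l; first by rewrite lee_fin exprn_ge0// ltW.
  apply: (le_trans (generalized_Boole_inequality Q (mF' j) (mF j))).
  by apply: lee_nneseries => // k _; case: ifP => _; rewrite ?measure0.
rewrite lte_mul_pinfty// lee_fin divr_ge0//; first exact: ltW.
by rewrite subr_ge0 ltW.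
Qed.

End radius.

(** * Moment bounds and the equivalence *)

Section subcritical.
Context {R : realType} (n : nat) {dO : measure_display}
  {Omega : measurableType dO} (P : probability Omega R).
Hypothesis n_ge2 : (2 <= n)%N.
Variables (xi : Omega -> set ('rV[R]_n * R)) (nu : probability R R) (lambda : R).
Hypothesis lambda_gt0 : 0 < lambda.
Hypothesis H : poisson_point_process P xi (boolean_intensity nu lambda).
Variable s : R.
Hypothesis s_gt0 : 0 < s.
Local Notation T := (scale n).
Local Notation b := (T%:R `^ s).
Local Notation mu := (boolean_intensity (d := n) nu lambda).
Hypothesis layers_fin : (layers_sum n nu s < +oo)%E.

Let lambda_ge0 := ltW lambda_gt0.

Let b_gt1 : 1 < b.
Proof. exact: scale_powR_gt1. Qed.

Let bX_ge0 k : 0 <= b ^+ k.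
Proof. by rewrite exprn_ge0// ltW// (lt_trans _ b_gt1). Qed.

Let const_ge0 : 0 <= lambda * shell_const n.
Proof.
rewrite mulr_ge0// exprn_ge0// !mulr_ge0// ?exprn_ge0//.
by rewrite /ctr_ratio addr_ge0// mulr_ge0.
Qed.

Let term_ge0 k : (0 <= ((T%:R ^+ k) ^+ n)%:E * nu (layer n k))%E.
Proof. by rewrite mule_ge0// lee_fin !exprn_ge0. Qed.

Lemma shell_sum : (\sum_(k <oo) (b ^+ k)%:E * mu (shell k) =
  (lambda * shell_const n)%:E * layers_sum n nu s)%E.
Proof.
rewrite /layers_sum -nneseriesZl; last first.
  by move=> k _; rewrite mule_ge0// lee_fin.
by apply: eq_eseriesr => k _; rewrite (mu_shell n_ge2) muleCA.
Qed.

Lemma shell_sum_fin : (\sum_(k <oo) (b ^+ k)%:E * mu (shell k) < +oo)%E.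
Proof. by rewrite shell_sum lte_mul_pinfty// lee_fin. Qed.

(** Dropping the weights, all at least 1, leaves a bound linear in [lambda], which serves as [V] in
    [crossing_prob_small]. *)
Lemma shell_sum1_le : (\sum_(k <oo) mu (shell k) <=
  (lambda * shell_const n * fine (layers_sum n nu s))%:E)%E.
Proof.
have l0 : (0 <= layers_sum n nu s)%E.
  by apply: nneseries_ge0 => k _ _; rewrite mule_ge0// lee_fin.
rewrite EFinM fineK ?ge0_fin_numE// -shell_sum; apply: lee_nneseries => k _.
  by move=> _; exact: mu_shell_ge0.
rewrite -[leLHS]mul1e lee_wpmul2r//; first exact: mu_shell_ge0.
by rewrite lee_fin exprn_ege1// ltW.
Qed.

Lemma moments_finite j0 :
  (forall j, (j0 <= j)%N ->
     mesh_const n * crossing_prob P xi j <= (2 * b)^-1) ->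
  [/\ (\int[P]_w (cluster_volume (xi w) `^ (s / n%:R)) < +oo)%E,
      (\int[P]_w (cluster_card (xi w) `^ (s / n%:R)) < +oo)%E
    & (\int[P]_w (cluster_diam (xi w) `^ s) < +oo)%E].
Proof.
move=> small.
have esc := sum_escape n_ge2 lambda_ge0 H b_gt1 shell_sum_fin small.
split.
- exact: (volume_moment_upper n_ge2 H s_gt0 esc).
- exact: (card_moment_upper n_ge2 lambda_gt0 H s_gt0 esc).
- exact: (diam_moment_upper n_ge2 H s_gt0 esc).
Qed.

End subcritical.

Theorem theorem2 (R : realType) (d : nat) (d_ge2 : (2 <= d)%N)
  (nu : probability R R) (nu_pos : nu `]0, +oo[%classic = 1%E)
  (dQ : measure_display) (Q_space : measurableType dQ)
  (Q : probability Q_space R) (rad : {RV Q >-> R})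
  (rad_nu : forall A : set R, measurable A -> distribution Q rad A = nu A)
  (s : R) (s_gt0 : 0 < s)
  (dO : R -> measure_display)
  (Omega : forall lambda : R, measurableType (dO lambda))
  (P : forall lambda : R, probability (Omega lambda) R)
  (xi : forall lambda : R, Omega lambda -> set ('rV[R]_d * R))
  (xi_ppp : forall lambda : R, 0 < lambda ->
     poisson_point_process (P lambda) (xi lambda)
       (boolean_intensity nu lambda)) :
  let volume_moment (lambda : R) :=
    (\int[P lambda]_w (cluster_volume (xi lambda w) `^ (s / d%:R)))%E in
  let card_moment (lambda : R) :=
    (\int[P lambda]_w (cluster_card (xi lambda w) `^ (s / d%:R)))%E in
  let diam_moment (lambda : R) :=
    (\int[P lambda]_w (cluster_diam (xi lambda w) `^ s))%E in
  let radius_moment := 'E_Q[fun q => (rad q `^ (d%:R + s))%R]%E in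
  [<-> exists2 lambda0 : R, 0 < lambda0 &
         forall lambda, 0 < lambda < lambda0 -> (volume_moment lambda < +oo)%E;
       exists2 lambda0 : R, 0 < lambda0 &
         forall lambda, 0 < lambda < lambda0 -> (card_moment lambda < +oo)%E;
       exists2 lambda0 : R, 0 < lambda0 &
         forall lambda, 0 < lambda < lambda0 -> (diam_moment lambda < +oo)%E;
       (radius_moment < +oo)%E]
  /\ ((radius_moment < +oo)%E ->
      forall lambda, Lambda_hat P xi lambda ->
      [/\ (volume_moment lambda < +oo)%E, (card_moment lambda < +oo)%E
        & (diam_moment lambda < +oo)%E]).
Proof.
move=> volume_moment card_moment diam_moment radius_moment.
have d_gt0 : (0 < d)%N by exact: ltnW.
pose b : R := (scale d)%:R `^ s.
have b_gt1 : 1 < b by exact: scale_powR_gt1.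
have C0 : 0 < mesh_const d :> R by exact: mesh_const_gt0.
have e0 : 0 < (2 * b)^-1 by rewrite invr_gt0 mulr_gt0// (lt_trans _ b_gt1).
have iv_hat : (radius_moment < +oo)%E -> forall lambda, Lambda_hat P xi lambda ->
    [/\ (volume_moment lambda < +oo)%E, (card_moment lambda < +oo)%E
      & (diam_moment lambda < +oo)%E].
  move=> /(radius_layers d_ge2 rad_nu s_gt0) layers lambda [lambda_gt0 cv].
  have Hl := xi_ppp lambda lambda_gt0.
  have e1 : 0 < (2 * b)^-1 / mesh_const d by rewrite divr_gt0.
  have [j0 j0P] := crossing_prob_eventually_small d_ge2 Hl e1 cv.
  apply: (moments_finite d_ge2 lambda_gt0 Hl s_gt0 layers (j0 := j0)) => j /j0P.
  by rewrite ler_pdivlMr// mulrC.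
have iv_small : (radius_moment < +oo)%E -> exists2 lambda0 : R, 0 < lambda0 &
    forall lambda, 0 < lambda < lambda0 ->
    [/\ (volume_moment lambda < +oo)%E, (card_moment lambda < +oo)%E
      & (diam_moment lambda < +oo)%E].
  move=> /(radius_layers d_ge2 rad_nu s_gt0) layers.
  pose S := fine (layers_sum d nu s).
  have S0 : 0 <= S.
    apply: fine_ge0; apply: nneseries_ge0 => k _ _.
    by rewrite !mule_ge0// lee_fin !exprn_ge0// ltW// (lt_trans _ b_gt1).
  have ctr0 : 0 < ctr_ratio d :> R by rewrite /ctr_ratio ltr_wpDl// mulr_ge0.
  pose a : R := (2 * ctr_ratio d) ^+ d.
  have a0 : 0 < a by rewrite exprn_gt0// mulr_gt0.
  have sc0 : 0 < shell_const d :> R.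
    by rewrite exprn_gt0// mulr_gt0// mulr_gt0// scaleX_gt0.
  (* [lambda * a] bounds the first crossing probability and [lambda * shell_const d * S] the total
     mean of the shells; with [D], one threshold on [lambda] controls both. *)
  pose D := a + shell_const d * S.
  have D0 : 0 < D by rewrite ltr_pwDl// mulr_ge0// ltW.
  have e4 : 0 < (4 * b)^-1 by rewrite invr_gt0 mulr_gt0// (lt_trans _ b_gt1).
  exists ((4 * b)^-1 / (mesh_const d * D)); first by rewrite divr_gt0// mulr_gt0.
  have md0 : 0 < mesh_const d * D by rewrite mulr_gt0.
  move=> lambda /andP[lambda_gt0]; rewrite (ltr_pdivlMr _ _ md0) => /ltW lb.
  have Hl := xi_ppp lambda lambda_gt0; have l0 := ltW lambda_gt0.
  apply: (moments_finite d_ge2 lambda_gt0 Hl s_gt0 layers (j0 := 0)) => j _.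
  apply: (crossing_prob_small d_ge2 l0 Hl (ltW b_gt1)
    (shell_sum1_le d_ge2 lambda_gt0 s_gt0 layers)).
  - have x0 := crossing_prob0_le l0 Hl.
    apply: (@le_trans _ _ (4 * b)^-1); last first.
      by rewrite lef_pV2 ?posrE ?mulr_gt0 ?(lt_trans _ b_gt1)// ler_pM2r ?ler_nat// (lt_trans _ b_gt1).
    apply: le_trans lb; rewrite mulrCA ler_pM2l//.
    by apply: le_trans x0 _; rewrite ler_pM2l// -/a /D lerDl mulr_ge0// ltW.
  - apply: le_trans lb; rewrite -mulrA mulrCA ler_pM2l// ler_pM2l//.
    by rewrite /D lerDr ltW.
have vol_iv lambda : 0 < lambda -> (volume_moment lambda < +oo)%E ->
    (radius_moment < +oo)%E.
  move=> lambda_gt0 /(volume_moment_lower d_ge2 lambda_gt0 (xi_ppp _ lambda_gt0) s_gt0).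
  exact: (layers_radius d_ge2 rad_nu s_gt0).
have card_iv lambda : 0 < lambda -> (card_moment lambda < +oo)%E ->
    (radius_moment < +oo)%E.
  move=> lambda_gt0 /(card_moment_lower d_ge2 lambda_gt0 (xi_ppp _ lambda_gt0) s_gt0).
  exact: (layers_radius d_ge2 rad_nu s_gt0).
have diam_iv lambda : 0 < lambda -> (diam_moment lambda < +oo)%E ->
    (radius_moment < +oo)%E.
  move=> lambda_gt0 /(diam_moment_lower d_ge2 lambda_gt0 (xi_ppp _ lambda_gt0) s_gt0).
  exact: (layers_radius d_ge2 rad_nu s_gt0).
(* Each cluster moment is exploited at a single intensity, half of its threshold. *)
have half (l : R) : 0 < l -> 0 < l / 2 < l.
  by move=> l0; apply/andP; split; [rewrite divr_gt0|rewrite ltr_pdivrMr// ltr_pMr// ltr1n].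
split; last exact: iv_hat.
(* The steps from (i) to (ii) and from (ii) to (iii) both pass through (iv), at the cost of a new
   threshold. *)
tfae.
- move=> [l0 l0_gt0 /(_ _ (half _ l0_gt0))]; have /andP[h _] := half _ l0_gt0.
  move=> /(vol_iv _ h) /iv_small[l l_gt0 lP].
  by exists l => // lambda /lP[].
- move=> [l0 l0_gt0 /(_ _ (half _ l0_gt0))]; have /andP[h _] := half _ l0_gt0.
  move=> /(card_iv _ h) /iv_small[l l_gt0 lP].
  by exists l => // lambda /lP[].
- move=> [l0 l0_gt0 /(_ _ (half _ l0_gt0))]; have /andP[h _] := half _ l0_gt0.
  exact: diam_iv.
- move=> /iv_small[l l_gt0 lP].
  by exists l => // lambda /lP[].
Qed.
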